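(* Let $m,n$ be positive integers. Every triple of partitions $(\lambda,\mu,\nu)$ with $\ell(\lambda)\le mn$, $\ell(\mu)\le m$, $\ell(\nu)\le n$ satisfying $$\mu_u=\lambda_u+\sum_{i=m+(u-1)(n-1)+1}^{m+u(n-1)}\lambda_i\ (u=1,\dots,m),\quad \nu_1=\sum_{i=1}^m\lambda_i,\quad \nu_v=\sum_{i=0}^{m-1}\lambda_{m+(n-1)i+v-1}\ (v=2,\dots,n)\qquad(\ast)$$ is a stable triple. Moreover, the cone $\tau_{m,n}$ is a stable face of $PKron_{mn,m,n}$.
   Context: Partitions are padded with zeros: $\lambda=(\lambda_1,\dots,\lambda_{mn})$, $\mu=(\mu_1,\dots,\mu_m)$, $\nu=(\nu_1,\dots,\nu_n)$; $g_{\lambda,\mu,\nu}$ is the Kronecker coefficient (multiplicity of $V_\lambda$ in $V_\mu\otimes V_\nu$ as $\mathfrak S_N$-modules, zero if sizes differ). Sums of partitions are taken componentwise, $k\lambda$ multiplies each part by $k$. A triple $(\lambda,\mu,\nu)$ is stable if for all partitions $\alpha,\beta,\gamma$ the sequence $(g_{\alpha+k\lambda,\beta+k\mu,\gamma+k\nu})_{k\ge0}$ is eventually constant. It is weakly stable if $g_{k\lambda,k\mu,k\nu}=1$ for every positive integer $k$. For positive integers $l,m,n$, $PKron_{l,m,n}\subset\mathbb R^{l+m+n}$ is the rational polyhedral cone generated by the semigroup $\{(\lambda,\mu,\nu)\in\mathbb Z^{l+m+n}: g_{\lambda,\mu,\nu}\ne0,\ \ell(\lambda)\le l,\ell(\mu)\le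 m,\ell(\nu)\le n\}$; $W_{l,m,n}$ is the lattice of $(\lambda,\mu,\nu)\in\mathbb Z^{l+m+n}$ with $|\lambda|=|\mu|=|\nu|$; $SKron_{l,m,n}$ is the set of weakly stable triples with these length bounds. A stable face of $PKron_{l,m,n}$ is a face whose intersection with $W_{l,m,n}$ is contained in $SKron_{l,m,n}$. $\tau_{m,n}\subset\mathbb R^{mn+m+n}$ is the cone of $(\lambda,\mu,\nu)$ satisfying the equations $(\ast)$ together with $\lambda_1\ge\dots\ge\lambda_{mn}\ge0$, $\mu_1\ge\dots\ge\mu_m\ge0$, $\nu_1\ge\dots\ge\nu_n\ge0$. *)

(* Defs.v *)
From HB Require Import structures.
From mathcomp Require Import all_boot all_order all_algebra all_fingroup.
From mathcomp Require Import reals.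
From mathcomp Require Import mpoly.

Set Implicit Arguments.
Unset Strict Implicit.
Unset Printing Implicit Defensive.

Import Order.TTheory GRing.Theory Num.Theory.
Local Open Scope ring_scope.

(* Partitions are sequences of naturals, implicitly padded with zeros. *)
Definition is_partition (s : seq nat) : bool := sorted geq s.
Definition ell (s : seq nat) : nat := count (fun x => 0 < x)%N s.
Definition padd (s t : seq nat) : seq nat :=
  mkseq (fun i => nth 0%N s i + nth 0%N t i)%N (maxn (size s) (size t)).
Definition pscale (k : nat) (s : seq nat) : seq nat := map (muln k) s.

(* Irreducible characters of S_N via the Frobenius formula:
   chi^lambda(sigma) = [x^(lambda + delta)] a_delta * p_{type(sigma)}
   in N variables x_0..x_{N-1}, with delta = (N-1, ..., 1, 0),
   a_delta = prod_{i<j} (x_i - x_j) the Vandermonde determinant. *)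
Definition vdm (N : nat) : {mpoly int[N]} :=
  \prod_(i < N) \prod_(j < N | (i < j)%N) ('X_i - 'X_j).
Definition psum (N k : nat) : {mpoly int[N]} := \sum_(i < N) 'X_i ^+ k.
Definition frob_mono (N : nat) (la : seq nat) : 'X_{1..N} :=
  [multinom (nth 0%N la i + (N.-1 - i))%N | i < N].
Definition chi (N : nat) (la : seq nat) (s : 'S_N) : int :=
  (vdm N * \prod_(C in porbits s) psum N #|C|)@_(frob_mono N la).

(* Kronecker coefficient g_{la,mu,nu}: multiplicity of V_la in V_mu (x) V_nu,
   i.e. (1/N!) sum_sigma chi^la chi^mu chi^nu; zero if the sizes differ
   (or if an argument is not a partition). *)
Definition kron (la mu nu : seq nat) : rat :=
  let N := sumn la in
  if [&& is_partition la, is_partition mu, is_partition nu,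
         sumn mu == N & sumn nu == N]
  then (N`!%:R)^-1 *
       \sum_(s : 'S_N) ((chi la s * chi mu s * chi nu s)%:~R : rat)
  else 0.

Definition stable_triple (la mu nu : seq nat) : Prop :=
  forall al be ga : seq nat,
    is_partition al -> is_partition be -> is_partition ga ->
    exists K : nat, forall k : nat, (K <= k)%N ->
      kron (padd al (pscale k la)) (padd be (pscale k mu)) (padd ga (pscale k nu))
      = kron (padd al (pscale K la)) (padd be (pscale K mu)) (padd ga (pscale K nu)).

Definition weakly_stable (la mu nu : seq nat) : Prop :=
  forall k : nat, (0 < k)%N -> kron (pscale k la) (pscale k mu) (pscale k nu) = 1.

(* The equations (star), 1-indexed: L i = lambda_i, M u = mu_u, V v = nu_v. *)
Definition star_eqs (T : nmodType) (m n : nat) (L M V : nat -> T) : Prop :=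
  [/\ (forall u, (1 <= u <= m)%N ->
         M u = L u + \sum_((m + (u - 1) * (n - 1)).+1 <= i < (m + u * (n - 1)).+1) L i),
      V 1%N = \sum_(1 <= i < m.+1) L i
    & (forall v, (2 <= v <= n)%N ->
         V v = \sum_(0 <= i < m) L (m + (n - 1) * i + v - 1)%N)].

(* Ambient space R^{l+m+n}: coordinates indexed by 'I_l + 'I_m + 'I_n. *)
Definition Idx (l m n : nat) : finType := ('I_l + 'I_m + 'I_n)%type.

Section Geometry.
Variable R : realType.
Variables l m n : nat.

Local Notation pt := {ffun Idx l m n -> R}.

Definition embed (la mu nu : seq nat) : pt :=
  [ffun t : Idx l m n => match t return R with
     | inl (inl i) => (nth 0%N la i)%:R
     | inl (inr j) => (nth 0%N mu j)%:R
     | inr k => (nth 0%N nu k)%:R end].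

Definition kron_semigroup (x : pt) : Prop :=
  exists la mu nu : seq nat,
    [/\ (ell la <= l)%N, (ell mu <= m)%N, (ell nu <= n)%N,
        kron la mu nu != 0 & x = embed la mu nu].

Definition PKron (x : pt) : Prop :=
  exists (r : nat) (c : 'I_r -> R) (g : 'I_r -> pt),
    (forall j, 0 <= c j /\ kron_semigroup (g j)) /\ x = [ffun t => \sum_(j < r) c j * g j t].

Definition in_W (x : pt) : Prop :=
  (exists z : Idx l m n -> int, x = [ffun t => (z t)%:~R]) /\
  (\sum_(i < l) x (inl (inl i)) = \sum_(j < m) x (inl (inr j)) /\
   \sum_(j < m) x (inl (inr j)) = \sum_(k < n) x (inr k)).

Definition in_SKron (x : pt) : Prop :=
  exists la mu nu : seq nat,
    [/\ (ell la <= l)%N, (ell mu <= m)%N, (ell nu <= n)%N,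
        weakly_stable la mu nu & x = embed la mu nu].

Definition is_face (C F : pt -> Prop) : Prop :=
  exists w : pt,
    (forall x, C x -> 0 <= \sum_t w t * x t) /\
    (forall x, F x <-> (C x /\ \sum_t w t * x t = 0)).

Definition stable_face (F : pt -> Prop) : Prop :=
  is_face PKron F /\ (forall x, F x -> in_W x -> in_SKron x).

End Geometry.

(* real coordinate, 1-indexed, zero outside the range *)
Definition coord1 (R : realType) (k : nat) (f : 'I_k -> R) (i : nat) : R :=
  if insub i.-1 is Some j then (if (0 < i)%N then f j else 0) else 0.

Definition tau (R : realType) (m n : nat) (x : {ffun Idx (m * n) m n -> R}) : Prop :=
  let L := coord1 (fun i => x (inl (inl i))) in
  let M := coord1 (fun j => x (inl (inr j))) in
  let V := coord1 (fun k => x (inr k)) in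
  [/\ star_eqs m n L M V,
      (forall i : 'I_(m * n), 0 <= x (inl (inl i))) /\
      (forall i j : 'I_(m * n), (i <= j)%N -> x (inl (inl j)) <= x (inl (inl i))),
      (forall i : 'I_m, 0 <= x (inl (inr i))) /\
      (forall i j : 'I_m, (i <= j)%N -> x (inl (inr j)) <= x (inl (inr i)))
    & (forall i : 'I_n, 0 <= x (inr i)) /\
      (forall i j : 'I_n, (i <= j)%N -> x (inr j) <= x (inr i))].

(* Main.v *)
Require Import Defs.
From HB Require Import structures.
From mathcomp Require Import all_boot all_order all_algebra all_fingroup.
From mathcomp Require Import reals.
From mathcomp Require Import mpoly zify ring lra.

(** Expanding the Vandermonde determinant in the Frobenius formula writes each character as
    an alternating sum of permutation characters on words, and counting orbits of words turns
    the Kronecker coefficient into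

      g(la, mu, nu) = sum_(w, w') sgn w sgn w' sum_A K(la, A),

    where [A] runs over the tables with row sums [mu_u + w u - u] and column sums
    [nu_v + w' v - v], and [K(la, A)] is the coefficient of [x^A] in the Schur polynomial.
    By Jacobi-Trudi, [K(la, A)] vanishes unless [A] is dominated by [la], is 1 for [A = la],
    and [K(al + k la, B + k la)] is eventually constant in [k].

    The star equations say that [la], written in the cells of a table in a certain order, has
    margins [mu] and [nu]; this order is additive: it is the order of the values
    [X_u + Y_v] for suitable weights.  Pairing a table with these values depends only on its
    margins, and by summation by parts it is minimal, among the tables dominated by [la], at
    [la] itself.  Hence only [A = la], [w = w' = 1] contributes to g(k la, k mu, k nu), the
    pairing defines a supporting hyperplane of the Kronecker cone which cuts out [tau], and
    for (al + k la, be + k mu, ga + k nu) the tables that contribute are [k la + B] with [B]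
    in a finite set independent of [k]. *)

Set Implicit Arguments.
Unset Strict Implicit.
Unset Printing Implicit Defensive.

Import Order.TTheory GRing.Theory Num.Theory.
Local Open Scope ring_scope.

(** * Characters as alternating sums of fixed-word counts *)

Definition content (U : finType) (N : nat) (f : {ffun 'I_N -> U}) (u : U) : nat :=
  #|[set x | f x == u]|.

Definition fixword (U : finType) (N : nat) (s : 'S_N) (f : {ffun 'I_N -> U}) : bool :=
  [forall x, f (s x) == f x].

(** The character at [s] of the permutation module on words of content [a]. The content is
    integer-valued because the exponents of the alternating sums below can be negative; such a
    content has no words. *)
Definition permchar (U : finType) (N : nat) (s : 'S_N) (a : U -> int) : int :=
  \sum_(f : {ffun 'I_N -> U} |
        fixword s f && [forall u, (content f u)%:Z == a u]) 1.

Lemma fixword_porbit (U : finType) (N : nat) (s : 'S_N) (f : {ffun 'I_N -> U}) x y :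
  fixword s f -> porbit s x = porbit s y -> f x = f y.
Proof.
move=> /forallP fs e; have : x \in porbit s y by rewrite -e porbit_id.
case/porbitP=> i ->; elim: i => [|i IH]; first by rewrite expg0 perm1.
by rewrite expgSr permM (eqP (fs _)).
Qed.

(** A word fixed by [s] is constant on each cycle, so choosing one variable per cycle in the product
    of power sums amounts to choosing a fixed word. *)
Lemma prod_psum (N n : nat) (s : 'S_N) :
  \prod_(C in porbits s) psum n #|C| =
  \sum_(f : {ffun 'I_N -> 'I_n} | fixword s f) 'X_[[multinom content f i | i < n]].
Proof.
pose O := {C : {set 'I_N} | C \in porbits s}.
have pP x : porbit s x \in porbits s by apply: imset_f.
pose po x : O := Sub (porbit s x) (pP x).
have poS (C : O) : exists x, po x == C.
  by case: C => C CP; case/imsetP: (CP) => x _ e; exists x; rewrite -val_eqE /= e.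
pose rp (C : O) := xchoose (poS C).
have rpK : cancel rp po by move=> C; apply/eqP; exact: (xchooseP (poS C)).
have prodcont (f : {ffun 'I_N -> 'I_n}) :
   \prod_x 'X_(f x) = 'X_[[multinom content f i | i < n]] :> {mpoly int[n]}.
  rewrite mpolyXE_id (partition_big f predT) //=; apply: eq_bigr => i _.
  rewrite mnmE /content (eq_bigr (fun=> 'X_i)); last by move=> x /eqP ->.
  by rewrite big_const cardsE -Monoid.iteropE /=.
rewrite (big_sub _ (fun C : {set _} => psum n #|C|)) /psum bigA_distr_bigA /=.
(* [h] samples a word at the representatives of the cycles and [h'] spreads a choice per cycle along
   the cycles; the words recovered by [h'] after [h] are exactly the fixed ones. *)
pose h (f : {ffun 'I_N -> 'I_n}) : {ffun O -> 'I_n} := [ffun C => f (rp C)].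
pose h' (g : {ffun O -> 'I_n}) : {ffun 'I_N -> 'I_n} := [ffun x => g (po x)].
rewrite (reindex_onto h h') /=; last first.
  by move=> g _; apply/ffunP=> C; rewrite !ffunE rpK.
apply: eq_big => [f|f /eqP fE].
  apply/eqP/idP => [<-|fs].
    apply/forallP=> x; rewrite !ffunE; apply/eqP; congr (f (rp _)).
    by apply: val_inj; exact: (porbit_perm s 1 x).
  apply/ffunP=> x; rewrite !ffunE; apply: fixword_porbit fs _.
  by have /(congr1 val) := rpK (po x).
rewrite -{2}fE -prodcont (partition_big po predT) //=.
apply: eq_bigr => C _; rewrite (eq_bigr (fun=> 'X_(h f C))); last first.
  by move=> x /eqP <-; rewrite ffunE.
rewrite big_const -Monoid.iteropE /=; congr (_ ^+ _); apply: eq_card => x.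
transitivity (porbit s x == val C); last by [].
case: C => C CP /=; case/imsetP: CP => y _ ->.
by rewrite eq_porbit_mem.
Qed.

(** The Vandermonde matrix is taken in the variables in reverse order, which turns the factors of
    [det_Vandermonde] into those of [vdm] without a sign. *)
Lemma vdmE (N : nat) :
  vdm N = \sum_(w : 'S_N) (-1) ^+ w * 'X_[[multinom (N.-1 - w i)%N | i < N]].
Proof.
pose a : 'rV[{mpoly int[N]}]_N := \row_j 'X_(rev_ord j).
transitivity (\det (Vandermonde N a)).
  rewrite det_Vandermonde (reindex_inj rev_ord_inj) /=.
  rewrite /vdm (exchange_big_dep predT) //=; apply: eq_bigr => i _.
  rewrite [RHS](reindex_inj rev_ord_inj) /=; apply: eq_big => j.
    by case: i j => [i hi] [j hj] /=; lia.
  by rewrite !mxE !rev_ordK.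
pose r : 'S_N := perm rev_ord_inj.
have rE i : r i = rev_ord i by rewrite permE.
(* In the Leibniz term of [h w], the variable of index [r (h w i)] has exponent i. Inverting and
   conjugating by the reversal [r] makes the exponent of ['X_i] equal to N - 1 - w i and preserves
   the sign. *)
pose h (w : 'S_N) : 'S_N := ((r * w * r)^-1)%g.
have rr : (r * r = 1)%g by apply/permP=> i; rewrite permM !rE rev_ordK perm1.
have rV : (r^-1 = r)%g by apply/eqP; rewrite eq_invg_mul rr.
have hE w : h w = (r * w^-1 * r)%g by rewrite /h !invMg rV mulgA.
have hK : cancel h h.
  by move=> w; rewrite {1}/h hE !mulgA rr mul1g -mulgA rr mulg1 invgK.
rewrite /determinant (reindex_inj (can_inj hK)) /=; apply: eq_bigr => w _.
congr (_ * _).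
  by rewrite odd_permV !odd_permM addbC addbA addbb.
rewrite mpolyXE_id.
have inj : injective (fun i => r (h w i)) by move=> i j /perm_inj/perm_inj.
rewrite [RHS](reindex_inj inj) /=; apply: eq_bigr => i _.
rewrite !mxE mnmE -rE; congr (_ ^+ _).
have := permKV (r * w * r)%g i; rewrite !permM -/(h w) !rE => /(congr1 val) /=.
have := ltn_ord (w (rev_ord (h w i))); have := ltn_ord i.
by lia.
Qed.

(** The number n of variables is separate from the degree N, so that a character can be expanded
    over just as many rows as needed. *)
Definition altchar (n N : nat) (s : 'S_N) (la : nat -> nat) : int :=
  \sum_(w : 'S_n) (-1) ^+ w * permchar s (fun i : 'I_n => (la i)%:Z + (w i)%:Z - i%:Z).

Lemma chi_altchar (N : nat) (la : seq nat) (s : 'S_N) :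
  chi la s = altchar N s (nth 0%N la).
Proof.
rewrite /chi vdmE prod_psum mulr_suml raddf_sum /=; apply: eq_bigr => w _.
have -> : ((-1) ^+ w) = ((-1) ^+ w)%:MP :> {mpoly int[N]}.
  by case: (odd_perm w); rewrite ?expr0 ?expr1 ?rmorphN ?rmorph1.
rewrite -mulrA mcoeffCM; congr (_ * _); rewrite /permchar mulr_sumr raddf_sum /=.
rewrite [RHS]big_mkcondr /=; apply: eq_bigr => f _.
rewrite -mpolyXD mcoeffX; case: ifPn => [/forallP e|ne].
  suff -> : ([multinom (N.-1 - w i)%N | i < N] + [multinom content f i | i < N] =
     frob_mono N la)%MM by rewrite eqxx.
  apply/mnmP=> i; rewrite mnmDE !mnmE; have /eqP := e i.
  by have := ltn_ord (w i); have := ltn_ord i; lia.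
case: eqP => // /mnmP e; case/negP: ne; apply/forallP=> i; apply/eqP.
have := e i; rewrite mnmDE !mnmE.
by have := ltn_ord (w i); have := ltn_ord i; lia.
Qed.

Lemma eq_permchar (U : finType) (N : nat) (s : 'S_N) (a b : U -> int) :
  a =1 b -> permchar s a = permchar s b.
Proof.
move=> ab; apply: eq_bigl => f; congr (_ && _).
by apply: eq_forallb => u; rewrite ab.
Qed.

Lemma permchar_eq0 (U : finType) (N : nat) (s : 'S_N) (a : U -> int) u :
  a u < 0 -> permchar s a = 0.
Proof.
move=> au; rewrite /permchar big1 // => f /andP[_ /forallP/(_ u)/eqP e].
by move: au; rewrite -e.
Qed.

Lemma permcharE (U : finType) (N : nat) (s : 'S_N) (a : U -> int) :
  permchar s a = (#|[set f : {ffun 'I_N -> U} |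
        fixword s f && [forall u, (content f u)%:Z == a u]]|)%:Z.
Proof.
rewrite /permchar -natz -sum1_card natr_sum; apply: eq_bigl => f.
by rewrite inE.
Qed.

Lemma permchar_inj (U V : finType) (h : U -> V) (N : nat) (s : 'S_N) (b : V -> int) :
  injective h -> (forall v, v \notin codom h -> b v = 0) ->
  permchar s b = permchar s (b \o h).
Proof.
move=> hI b0; rewrite !permcharE; congr (_%:Z).
pose H (f : {ffun 'I_N -> U}) : {ffun 'I_N -> V} := [ffun x => h (f x)].
have HI : injective H.
  by move=> f g /ffunP e; apply/ffunP=> x; have := e x; rewrite !ffunE => /hI.
rewrite -(card_imset _ HI); apply: eq_card => g.
have contH f u : content (H f) (h u) = content f u.
  by apply: eq_card => x; rewrite !inE ffunE (inj_eq hI).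
have fixH f : fixword s (H f) = fixword s f.
  by apply: eq_forallb => x; rewrite !ffunE (inj_eq hI).
apply/idP/imsetP => [|[f]]; rewrite !inE.
  case/andP=> gs /forallP gc.
  have ex x : exists u, h u = g x.
    have [/codomP[u ->]|/b0 e] := boolP (g x \in codom h); first by exists u.
    have := gc (g x); rewrite e => /eqP[] /eqP; rewrite cards_eq0 => /eqP/setP/(_ x).
    by rewrite !inE eqxx.
  have [f fE] := fin_all_exists ex.
  have gE : g = H [ffun x => f x] by apply/ffunP=> x; rewrite !ffunE fE.
  exists [ffun x => f x] => //; rewrite inE -fixH -gE gs /=.
  by apply/forallP=> u; rewrite -contH -gE.
move=> /andP[fs /forallP fc ->]; rewrite fixH fs /=; apply/forallP=> v.
have [/codomP[u ->]|vn] := boolP (v \in codom h); first by rewrite contH fc.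
rewrite b0 //; apply/eqP; congr (_%:Z); apply/eqP; rewrite cards_eq0.
by apply/eqP/setP=> x; rewrite !inE ffunE; apply: contraNF vn => /eqP <-; apply: codom_f.
Qed.

(** With a zero last part, a permutation that moves the last index asks for a negative content
    there, so only permutations of the first n indices contribute. *)
Lemma altcharS (n N : nat) (s : 'S_N) (la : nat -> nat) :
  la n = 0%N -> altchar n.+1 s la = altchar n s la.
Proof.
move=> lan; rewrite /altchar (bigID (fun w : 'S_n.+1 => w ord_max == ord_max)) /=.
rewrite addrC big1 ?add0r => [|w wn]; last first.
  rewrite (@permchar_eq0 _ _ _ _ ord_max) ?mulr0 //= lan.
  have := ltn_ord (w ord_max); move: wn; rewrite -val_eqE /=; lia.
rewrite (reindex (lift_perm ord_max ord_max)); last first.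
  (* [ulsf i w] deletes i from the domain and [w i] from the codomain; at the last index this
     inverts [lift_perm] on the permutations fixing that index. *)
  pose ulsf i (w : 'S_n.+1) k := odflt k (unlift (w i) (w (lift i k))).
  have ulsfK i (w : 'S_n.+1) k : lift (w i) (ulsf i w k) = w (lift i k).
    rewrite /ulsf; have:= neq_lift i k.
    by rewrite -(can_eq (permK w)) => /unlift_some[] ? ? ->.
  have inj_ulsf : injective (ulsf ord_max _).
    move=> w; apply: can_inj (ulsf (w ord_max) w^-1%g) _ => k'.
    by rewrite {1}/ulsf ulsfK !permK liftK.
  exists (fun w => perm (inj_ulsf w)) => [w _ | w].
    by apply/permP=> k'; rewrite permE /ulsf lift_perm_lift lift_perm_id liftK.
  move/eqP=> wn; apply/permP=> k.
  case: (unliftP ord_max k) => [k'|] ->; rewrite ?lift_perm_id //.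
  by rewrite lift_perm_lift permE -{1}wn ulsfK.
apply: eq_big => [w|w _]; first by rewrite lift_perm_id eqxx.
rewrite odd_lift_perm addbb addFb; congr (_ * _).
rewrite (permchar_inj _ (@lift_inj _ ord_max)) => [|v vn].
  apply: eq_permchar => i /=; rewrite lift_perm_lift /= /bump.
  have hi : (n <= i)%N = false by apply/negbTE; rewrite -ltnNge ltn_ord.
  have hw : (n <= w i)%N = false by apply/negbTE; rewrite -ltnNge ltn_ord.
  by rewrite hi hw !add0n.
case: (unliftP ord_max v) => [k e|->]; last by rewrite lift_perm_id /= lan; lia.
by case/negP: vn; rewrite e codom_f.
Qed.

Lemma altchar_stable (n n' N : nat) (s : 'S_N) (la : nat -> nat) :
  (n <= n')%N -> (forall i, (n <= i)%N -> la i = 0%N) ->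
  altchar n' s la = altchar n s la.
Proof.
move=> le0 la0; rewrite -(subnK le0); elim: (n' - n)%N => // d IH.
by rewrite addSn altcharS ?IH // la0 // leq_addl.
Qed.

(** * Counting orbits of words *)

Lemma content_le (U : finType) (N : nat) (f : {ffun 'I_N -> U}) u : (content f u <= N)%N.
Proof. by rewrite /content -[X in (_ <= X)%N]card_ord; exact: max_card. Qed.

Lemma content_comp (U W : finType) (r : W -> U) (N : nat) (f : {ffun 'I_N -> W}) u :
  content [ffun x => r (f x)] u = (\sum_(w | r w == u) content f w)%N.
Proof.
rewrite /content -sum1_card (partition_big f (fun w => r w == u)) /=; last first.
  by move=> x; rewrite inE ffunE.
apply: eq_bigr => w /eqP rw; rewrite -sum1_card; apply: eq_bigl => x.
by rewrite !inE ffunE; case: (f x =P w) => [->|_]; rewrite ?rw ?eqxx ?andbF.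
Qed.

(** A pair of fixed words is one fixed word in the letters [W], which stand for pairs; grouping by
    its content gives a table with the two contents as margins. The bound [D] only makes the tables
    a finite type. *)
Lemma permcharM (U V W : finType) (r : W -> U) (q : W -> V) (cell : U -> V -> W)
    (N D : nat) (s : 'S_N) (b : U -> int) (c : V -> int) :
  (forall u v, r (cell u v) = u) -> (forall u v, q (cell u v) = v) ->
  (forall w, cell (r w) (q w) = w) -> (N <= D)%N ->
  permchar s b * permchar s c =
  \sum_(M : {ffun W -> 'I_D.+1} |
      [forall u, (\sum_(w | r w == u) (M w : nat))%N%:Z == b u] &&
      [forall v, (\sum_(w | q w == v) (M w : nat))%N%:Z == c v])
    permchar s (fun w => (M w)%:Z).
Proof.
move=> rc qc crq ND; rewrite /permchar big_distrlr /= pair_big /=.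
pose h (F : {ffun 'I_N -> W}) : {ffun 'I_N -> U} * {ffun 'I_N -> V} :=
  ([ffun x => r (F x)], [ffun x => q (F x)]).
pose h' (p : {ffun 'I_N -> U} * {ffun 'I_N -> V}) : {ffun 'I_N -> W} :=
  [ffun x => cell (p.1 x) (p.2 x)].
have h'K : cancel h' h.
  by move=> [f g]; rewrite /h /h' /=; congr (_, _); apply/ffunP=> x; rewrite !ffunE /= ?rc ?qc.
have hK : cancel h h' by move=> F; apply/ffunP=> x; rewrite !ffunE /= crq.
rewrite (reindex h); last by exists h' => ? _.
rewrite (partition_big (fun F => [ffun w => inord (content F w)] : {ffun W -> 'I_D.+1})
  (fun M => [forall u, (\sum_(w | r w == u) (M w : nat))%N%:Z == b u] &&
      [forall v, (\sum_(w | q w == v) (M w : nat))%N%:Z == c v])) /=; last first.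
  move=> F /andP[/andP[_ /forallP fb] /andP[_ /forallP fc]].
  apply/andP; split; apply/forallP=> u.
    rewrite -(eqP (fb u)) content_comp; apply/eqP; congr (_%:Z); apply: eq_bigr => w _.
    by rewrite ffunE inordK // ltnS (leq_trans (content_le _ _)).
  rewrite -(eqP (fc u)) content_comp; apply/eqP; congr (_%:Z); apply: eq_bigr => w _.
  by rewrite ffunE inordK // ltnS (leq_trans (content_le _ _)).
apply: eq_bigr => M /andP[/forallP Mb /forallP Mc]; rewrite mulr1.
apply: eq_bigl => F.
have -> : [forall u, (content F u)%:Z == (M u)%:Z] =
   ([ffun w => inord (content F w)] == M).
  apply/forallP/eqP => [e|<- w].
    apply/ffunP=> w; rewrite ffunE; apply: val_inj.
    by rewrite /= inordK ?ltnS ?(leq_trans (content_le _ _)) //; have /eqP[] := e w.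
  by rewrite ffunE inordK ?ltnS ?(leq_trans (content_le _ _)).
apply/idP/idP => [/andP[/andP[/andP[fr _] /andP[fq _]] ->]|/andP[fF /eqP e]].
  rewrite andbT; apply/forallP=> x; rewrite -[F (s x)]crq -[F x]crq.
  have := forallP fr x; have := forallP fq x; rewrite !ffunE.
  by move=> /eqP -> /eqP ->.
have cE w : content F w = M w.
  by rewrite -e ffunE inordK // ltnS (leq_trans (content_le _ _)).
rewrite e eqxx andbT; apply/andP; split; apply/andP; split.
- by apply/forallP=> x; rewrite !ffunE (eqP (forallP fF x)).
- apply/forallP=> u; rewrite -(eqP (Mb u)) content_comp; apply/eqP; congr (_%:Z).
  by apply: eq_bigr => w _.
- by apply/forallP=> x; rewrite !ffunE (eqP (forallP fF x)).
apply/forallP=> u; rewrite -(eqP (Mc u)) content_comp; apply/eqP; congr (_%:Z).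
by apply: eq_bigr => w _.
Qed.

Section Burnside.
Variables (U : finType) (N : nat).

(** With products of permutations read from left to right, the inverse makes this a right action. *)
Definition wordact (F : {ffun 'I_N -> U}) (s : 'S_N) : {ffun 'I_N -> U} :=
  [ffun x => F ((s^-1)%g x)].

Lemma wordact1 F : wordact F 1 = F.
Proof. by apply/ffunP=> x; rewrite ffunE invg1 perm1. Qed.

Lemma wordactM F : act_morph wordact F.
Proof. by move=> s t; apply/ffunP=> x; rewrite !ffunE invMg permM. Qed.

Canonical wordact_action := TotalAction wordact1 wordactM.

Lemma content_count (F : {ffun 'I_N -> U}) u :
  content F u = count_mem u [tuple F i | i < N].
Proof.
rewrite /content -sum1_card -sum1_count /= big_map big_enum_cond /=.
by apply: eq_bigl => x; rewrite !inE.
Qed.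

Lemma content_wordact F s u : content (wordact F s) u = content F u.
Proof.
rewrite -[RHS](card_imset _ (@perm_inj _ s)); apply: eq_card => x; rewrite !inE ffunE.
apply/idP/imsetP => [e|[y]]; first by exists ((s^-1)%g x); rewrite ?inE ?permKV.
by rewrite inE => e ->; rewrite permK.
Qed.

Lemma content_exists (M : U -> nat) :
  (\sum_u M u)%N = N -> exists F : {ffun 'I_N -> U}, forall u, content F u = M u.
Proof.
move=> sM; pose t := flatten [seq nseq (M u) u | u <- enum U].
have st : size t == N.
  rewrite size_flatten /shape -map_comp sumnE big_map big_enum /= -sM.
  by apply/eqP; apply: eq_bigr => u _; rewrite size_nseq.
exists [ffun i => tnth (Tuple st) i] => u; rewrite content_count.
have -> : [tuple [ffun i => tnth (Tuple st) i] i | i < N] = Tuple st.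
  by apply: eq_from_tnth => i; rewrite tnth_mktuple ffunE.
rewrite /= count_flatten -map_comp sumnE big_map big_enum /=.
rewrite (bigD1 u) //= count_nseq /= eqxx mul1n big1 ?addn0 // => v /negbTE vu.
by rewrite count_nseq /= vu mul0n.
Qed.

(** Burnside's count: the words of a given content form a single orbit, so the numbers of fixed
    words add up to the order of the group. *)
Lemma sum_permchar (M : U -> nat) : (\sum_u M u)%N = N ->
  \sum_(s : 'S_N) permchar s (fun u => (M u)%:Z) = (N`!)%:Z.
Proof.
move=> sM; pose S := [set F : {ffun 'I_N -> U} | [forall u, content F u == M u]].
have actS : [acts [set: 'S_N], on S | wordact_action].
  apply/actsP=> s _ F; rewrite !inE /=; apply: eq_forallb => u.
  by rewrite content_wordact.
have := Frobenius_Cauchy actS.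
have [F0 F0M] := content_exists sM.
have -> : orbit wordact_action [set: 'S_N] @: S = [set orbit wordact_action [set: 'S_N] F0].
  apply/setP=> O; rewrite !inE; apply/imsetP/eqP => [[F]|->]; last first.
    by exists F0 => //; rewrite inE; apply/forallP=> u; rewrite F0M.
  rewrite inE => /forallP FM ->; apply/eqP; rewrite orbit_eq_mem.
  (* Words of equal content are rearrangements of each other, and the rearranging permutation puts
     them in one orbit. *)
  have /tuple_permP[p pE] : perm_eq [tuple F i | i < N] [tuple F0 i | i < N].
    by apply/allP=> u _; rewrite /= -!content_count (eqP (FM u)) F0M.
  apply/orbitP; exists (p^-1)%g; first by rewrite inE.
  apply/ffunP=> x; rewrite ffunE invgK.
  have /(congr1 (fun t => nth (F x) t x)) := pE.
  by rewrite -!tnth_nth !tnth_mktuple.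
rewrite cards1 mul1n cardsT card_Sn => <-.
rewrite -natz natr_sum [RHS](eq_bigl predT) => [|s]; last by rewrite inE.
apply: eq_bigr => s _; rewrite permcharE natz; congr (_%:Z).
apply: eq_card => F; rewrite !inE sub1set inE andbC; congr (_ && _).
apply/idP/eqP => /= [/forallP fs|e].
  by apply/ffunP=> x; rewrite ffunE -{2}[x](permKV s) (eqP (fs _)).
by apply/forallP=> x; rewrite -{1}e ffunE permK.
Qed.

End Burnside.

(** * The Jacobi-Trudi identity *)

Section JacobiTrudi.
Variables (L D : nat).
Local Notation R := {mpoly int[L]}.

Definition geom (j : 'I_L) : {poly R} := \sum_(d < D.+1) ('X_j *: 'X) ^+ d.

(* Complete homogeneous polynomials; the geometric series are cut at [D], so [hcomp r] is
   only meaningful for [r <= D]. *)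
Definition hcomp (r : int) : R :=
  if r is Posz k then (\prod_(j < L) geom j)`_k else 0.

(** The Schur polynomial in Jacobi-Trudi form; [schur_alt] relates it to the quotient of
    alternants. *)
Definition schur (la : nat -> nat) : R :=
  \det (\matrix_(i < L, j < L) hcomp ((la i)%:Z + j%:Z - i%:Z)).

Definition cofactors (k : 'I_L) : {poly R} := \prod_(j < L | j != k) (1 - 'X_j *: 'X).

Lemma coef_geom j l : (l <= D)%N -> (geom j)`_l = 'X_j ^+ l.
Proof.
move=> lD; rewrite coef_sum (bigD1 (Ordinal (lD : (l < D.+1)%N))) //=.
rewrite exprZn coefZ coefXn eqxx mulr1 big1 ?addr0 // => i.
by rewrite -val_eqE /= exprZn coefZ coefXn eq_sym => /negbTE ->; rewrite mulr0.
Qed.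

Lemma size_cofactors k : (size (cofactors k) <= L)%N.
Proof.
apply: leq_trans (size_poly_prod_leq _ _) _.
set S := (\sum_(_ < _ | _) _)%N.
have : (S <= 2 * #|[pred j : 'I_L | j != k]|)%N.
  rewrite /S -sum1_card big_distrr /=; apply: leq_sum => j _; rewrite muln1.
  apply: leq_trans (size_polyD _ _) _; rewrite size_poly1 size_polyN.
  by rewrite geq_max /= (leq_trans (size_scale_leq _ _)) // size_polyX.
have := cardC1 k; rewrite card_ord => e; have := ltn_ord k.
have -> : #|[pred j : 'I_L | j != k]| = L.-1 by rewrite -e; apply: eq_card.
by lia.
Qed.

(** Each factor [geom j] with j different from k meets 1 - x_j T, and their product is 1 modulo
    T^(D+1); up to degree [D] only the series of x_k is left. *)
Lemma coef_hgen_cofactors k l : (l <= D)%N ->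
  ((\prod_(j < L) geom j) * cofactors k)`_l = 'X_k ^+ l.
Proof.
move=> lD; rewrite (bigD1 k) //= -mulrA -big_split /=.
have [q ->] : exists q : {poly R},
    \prod_(j < L | j != k) (geom j * (1 - 'X_j *: 'X)) = 1 + 'X^(D.+1) * q.
  apply: (big_ind (fun p : {poly R} => exists q, p = 1 + 'X^(D.+1) * q)).
  - by exists 0; rewrite mulr0 addr0.
  - move=> _ _ [p ->] [q ->]; exists (p + q + p * ('X^(D.+1) * q)).
    by ring.
  move=> j _; exists (- ('X_j ^+ D.+1)%:P).
  rewrite mulrC -opprB mulNr -subrX1 exprZn opprB mulrN -mul_polyC mulrC.
  by [].
by rewrite mulrDr mulr1 coefD mulrCA coefXnM ltnS lD addr0 coef_geom.
Qed.

Lemma sum_ord_widen (T : nmodType) (F : nat -> T) a b : (a <= b)%N ->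
  (forall d, (a <= d)%N -> F d = 0) -> \sum_(d < b) F d = \sum_(d < a) F d.
Proof.
move=> ab F0; rewrite (big_ord_widen b F ab) [RHS]big_mkcond /=.
by apply: eq_bigr => d _; case: ltnP => // /F0.
Qed.

(** This is the coefficient of T^l in the preceding product, with summation index d = L - 1 - j. The
    ranges d < L and d <= l give the same sum: the cofactor has degree below L, and [hcomp] vanishes
    at negative degrees. *)
Lemma hcomp_row (k : 'I_L) l : (l <= D)%N ->
  \sum_(j < L) hcomp (l%:Z - (L.-1 - j)%N%:Z) * (cofactors k)`_(L.-1 - j) = 'X_k ^+ l.
Proof.
move=> lD; rewrite -(coef_hgen_cofactors k lD) mulrC coefM.
pose F d : R := hcomp (l%:Z - d%:Z) * (cofactors k)`_d.
rewrite [RHS](eq_bigr (fun d : 'I_l.+1 => F d)) => [|d _]; last first.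
  have dl : (d <= l)%N by rewrite -ltnS ltn_ord.
  by rewrite /F (subzn dl) /hcomp mulrC.
rewrite (reindex_inj rev_ord_inj) /= (eq_bigr (fun d : 'I_L => F d)) => [|d _]; last first.
  by rewrite /F; have := ltn_ord d => dL; have -> : (L.-1 - (L - d.+1) = d)%N by lia.
have F1 d : (l.+1 <= d)%N -> F d = 0.
  move=> ld; rewrite /F; have -> : l%:Z - d%:Z = Negz (d - l).-1 by lia.
  by rewrite mul0r.
have F2 d : (L <= d)%N -> F d = 0.
  by move=> ld; rewrite /F (nth_default 0) ?mulr0 // (leq_trans (size_cofactors k)).
by rewrite -(sum_ord_widen (leq_addr L l.+1) F1) -(sum_ord_widen (leq_addl l.+1 L) F2).
Qed.

Definition altmx (la : nat -> nat) : 'M[R]_L :=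
  \matrix_(i < L, k < L) 'X_k ^+ (la i + (L.-1 - i)).

(* The rows of the Jacobi-Trudi matrix are turned into powers of the variables by
   [H(T) * prod_(j != k) (1 - x_j T) = 1 / (1 - x_k T)]; no sign has to be tracked because
   the case [la = 0] evaluates the determinant of the cofactors. *)
Lemma schur_cofactors (la : nat -> nat) :
  (forall i, (i < L)%N -> (la i + L <= D)%N) ->
  schur la * \det (\matrix_(j < L, k < L) (cofactors k)`_(L.-1 - j)) = \det (altmx la).
Proof.
move=> laD; rewrite -det_mulmx; congr (\det _); apply/matrixP=> i k; rewrite !mxE.
rewrite -(@hcomp_row k (la i + (L.-1 - i))); last first.
  by have := laD i (ltn_ord i); have := ltn_ord i; lia.
apply: eq_bigr => j _; rewrite !mxE; congr (hcomp _ * _).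
by have := ltn_ord i; have := ltn_ord j; lia.
Qed.

Lemma schur0 : schur (fun=> 0%N) = 1.
Proof.
rewrite /schur -det_tr det_trig; last first.
  apply/is_trig_mxP => i j ij; rewrite !mxE.
  by have -> : 0%:Z + i%:Z - j%:Z = Negz (j - i).-1 by lia.
rewrite big1 // => i _; rewrite !mxE add0r subrr /=.
rewrite -horner_coef0 horner_prod big1 // => j _.
by rewrite horner_coef0 coef_geom.
Qed.

Lemma schur_alt (la : nat -> nat) :
  (forall i, (i < L)%N -> (la i + L <= D)%N) ->
  schur la * \det (altmx (fun=> 0%N)) = \det (altmx la).
Proof.
move=> laD; rewrite -(schur_cofactors laD) -schur_cofactors ?schur0 ?mul1r //.
by move=> i iL; have := laD i iL; lia.
Qed.

(** Setting the value to 0 when an entry is negative lets the recursion over shifted contents run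
    without side conditions. *)
Definition kostka (la : nat -> nat) (A : 'I_L -> int) : int :=
  if [forall i, 0 <= A i] then (schur la)@_[multinom `|A i|%N | i < L] else 0.

Lemma det_altmx la :
  \det (altmx la) =
  \sum_(w : 'S_L) ((-1) ^+ w)%:MP * 'X_[[multinom (la (w i) + (L.-1 - w i))%N | i < L]].
Proof.
rewrite -det_tr; apply: eq_bigr => w _; congr (_ * _).
  by case: (odd_perm w); rewrite ?expr0 ?expr1 ?rmorphN ?rmorph1.
rewrite mpolyXE_id; apply: eq_bigr => i _.
by rewrite !mxE mnmE.
Qed.

Lemma mcoeffMX_sub (p : R) (m k : 'X_{1..L}) :
  (p * 'X_[m])@_k = if (m <= k)%MM then p@_(k - m) else 0.
Proof.
case: ifPn => [le|nle]; first by rewrite -{1}(submK le) addmC mcoeffMX.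
apply/eqP; rewrite mcoeff_eq0; apply: contra nle => /msuppM_le /allpairsP[[a b] /= [_ + ->]].
rewrite msuppX inE => /eqP ->; apply/mnm_lepP=> i; rewrite mnmDE; exact: leq_addl.
Qed.

(** Compare the coefficients of x^(A + delta) in s_la a_delta = a_(la + delta), where delta is the
    staircase. *)
Lemma kostka_alt (la : nat -> nat) (A : 'I_L -> nat) :
  (forall i, (i < L)%N -> (la i + L <= D)%N) ->
  \sum_(w : 'S_L) (-1) ^+ w * kostka la (fun i => (A i)%:Z + (w i)%:Z - i%:Z) =
  \sum_(w : 'S_L) (-1) ^+ w *
     ([forall i : 'I_L, (A i + (L.-1 - i) == la (w i) + (L.-1 - w i))%N])%:R.
Proof.
move=> laD; have := schur_alt laD; rewrite !det_altmx => /(congr1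
  (fun p : R => p@_[multinom (A i + (L.-1 - i))%N | i < L])).
rewrite mulr_sumr !raddf_sum /= => e.
transitivity (\sum_(w : 'S_L) (schur la * (((-1) ^+ w)%:MP *
     'X_[[multinom (0 + (L.-1 - w i))%N | i < L]]))@_[multinom (A i + (L.-1 - i))%N | i < L]).
  apply: eq_bigr => w _; rewrite mulrCA mcoeffCM; congr (_ * _).
  rewrite mcoeffMX_sub /kostka.
  set c := [forall i, _]; set c' := (_ <= _)%MM.
  have -> : c' = c.
    apply/mnm_lepP/forallP => h i; have := h i; rewrite !mnmE;
      by have := ltn_ord i; have := ltn_ord (w i); lia.
  case: ifP => // /forallP h; congr (_@_ _); apply/mnmP=> i.
  rewrite mnmBE !mnmE.
  by have := h i; have := ltn_ord i; have := ltn_ord (w i); lia.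
rewrite e; apply: eq_bigr => w _; rewrite mcoeffCM mcoeffX; congr (_ * _%:R).
congr (nat_of_bool _); apply/eqP/forallP => [/mnmP h i|h].
  by have := h i; rewrite !mnmE => ->.
by apply/mnmP=> i; rewrite !mnmE; apply/eqP; rewrite eq_sym.
Qed.
End JacobiTrudi.

(** * Kostka numbers as alternating counts of tables *)

Section KostkaCount.
Variables (L D : nat).
Local Notation R := {mpoly int[L]}.

Lemma hcompE (r : int) :
  hcomp L D r = \sum_(f : {ffun 'I_L -> 'I_D.+1} | (\sum_j (f j : nat))%N%:Z == r)
      'X_[[multinom (f j : nat) | j < L]].
Proof.
have HE : \prod_(j < L) geom D j = \sum_(f : {ffun 'I_L -> 'I_D.+1})
    ('X_[[multinom (f j : nat) | j < L]] : R) *: 'X^(\sum_j (f j : nat)).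
  rewrite /geom bigA_distr_bigA /=; apply: eq_bigr => f _.
  rewrite mpolyXE_id (eq_bigr (fun j => ('X_j ^+ f j)%:P * 'X^(f j))); last first.
    by move=> j _; rewrite exprZn mul_polyC.
  rewrite big_split /= -rmorph_prod /= mul_polyC prodrXr; congr (_ *: _).
  by apply: eq_bigr => j _; rewrite mnmE.
case: r => k /=; last by rewrite big_pred0.
rewrite HE coef_sum [RHS]big_mkcond /=; apply: eq_bigr => f _.
rewrite coefZ coefXn eqz_nat eq_sym.
by case: eqP; rewrite ?mulr1 ?mulr0.
Qed.

Definition margins (M : {ffun 'I_L * 'I_L -> 'I_D.+1}) (a b : 'I_L -> int) : bool :=
  [forall u, (\sum_(p | p.1 == u) (M p : nat))%N%:Z == a u] &&
  [forall v, (\sum_(p | p.2 == v) (M p : nat))%N%:Z == b v].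

Lemma sum_pair1 (T U : finType) (V : nmodType) (F : T * U -> V) u :
  \sum_(p | p.1 == u) F p = \sum_v F (u, v).
Proof.
rewrite (reindex_onto (fun v => (u, v)) snd) => [|[x y] /= /eqP -> //].
by apply: eq_bigl => v /=; rewrite !eqxx.
Qed.

Lemma sum_pair2 (T U : finType) (V : nmodType) (F : T * U -> V) v :
  \sum_(p | p.2 == v) F p = \sum_u F (u, v).
Proof.
rewrite (reindex_onto (fun u => (u, v)) fst) => [|[x y] /= /eqP -> //].
by apply: eq_bigl => u /=; rewrite !eqxx.
Qed.

Lemma prod_hcomp (a : 'I_L -> int) (m : 'X_{1..L}) :
  (\prod_i hcomp L D (a i))@_m =
  \sum_(M : {ffun 'I_L * 'I_L -> 'I_D.+1} | margins M a (fun j => (m j)%:Z)) 1.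
Proof.
under eq_bigr do rewrite hcompE.
rewrite bigA_distr_big_dep /= raddf_sum /=.
pose h (M : {ffun 'I_L * 'I_L -> 'I_D.+1}) : {ffun 'I_L -> {ffun 'I_L -> 'I_D.+1}} :=
  [ffun i => [ffun j => M (i, j)]].
pose h' (g : {ffun 'I_L -> {ffun 'I_L -> 'I_D.+1}}) : {ffun 'I_L * 'I_L -> 'I_D.+1} :=
  [ffun p => g p.1 p.2].
have hK : cancel h h' by move=> M; apply/ffunP=> -[i j]; rewrite !ffunE.
have h'K : cancel h' h by move=> g; apply/ffunP=> i; apply/ffunP=> j; rewrite !ffunE.
rewrite (reindex h); last by exists h' => ? _.
rewrite /margins [RHS]big_mkcondr /=.
have rowE M i : (\sum_j (h M i j : nat))%N = (\sum_(p | p.1 == i) (M p : nat))%N.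
  by rewrite (sum_pair1 (fun p => M p : nat)); apply: eq_bigr => j _; rewrite !ffunE.
apply: eq_big => [M|M _].
  apply/forallP/forallP => H i; have := H i; rewrite -rowE; by [].
rewrite -(big_morph (fun m : 'X_{1..L} => 'X_[m] : R) (@mpolyXD L int) (mpolyX0 L int)) mcoeffX.
have colE j : (\sum_(i < L) [multinom (h M i j : nat) | j < L])%MM j =
   (\sum_(p | p.2 == j) (M p : nat))%N.
  rewrite mnm_sumE (sum_pair2 (fun p => M p : nat)).
  by apply: eq_bigr => i _; rewrite mnmE !ffunE.
case: ifP => [/forallP H|H].
  suff -> : (\sum_(i < L) [multinom (h M i j : nat) | j < L])%MM = m by rewrite eqxx.
  by apply/mnmP=> j; rewrite colE; have /eqP[] := H j.
case: eqP => // e; case/forallP: H => j; rewrite -e colE; by [].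
Qed.

Lemma kostka_count (la : nat -> nat) (A : 'I_L -> int) :
  kostka D la A = \sum_(w : 'S_L) (-1) ^+ w *
    \sum_(M : {ffun 'I_L * 'I_L -> 'I_D.+1} |
        margins M (fun i => (la i)%:Z + (w i)%:Z - i%:Z) A) 1.
Proof.
rewrite /kostka; case: ifPn => [/forallP A0|].
  rewrite /schur /determinant raddf_sum /=; apply: eq_bigr => w _.
  have -> : ((-1) ^+ w) = ((-1) ^+ w)%:MP :> R.
    by case: (odd_perm w); rewrite ?expr0 ?expr1 ?rmorphN ?rmorph1.
  rewrite mcoeffCM; congr (_ * _); under eq_bigr do rewrite mxE.
  rewrite prod_hcomp; apply: eq_bigl => M; rewrite /margins; congr (_ && _).
  by apply: eq_forallb => j; rewrite mnmE gez0_abs.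
rewrite negb_forall => /existsP[j Aj]; rewrite big1 // => w _.
rewrite big1 ?mulr0 // => M /andP[_ /forallP/(_ j)/eqP e].
by move: Aj; rewrite -e.
Qed.

(** The multiplicity of an irreducible character in a permutation character is a Kostka number: by
    [permcharM] and Burnside's count, the left side becomes N! times the alternating count of tables
    in [kostka_count]. *)
Lemma sum_altchar_permchar (N : nat) (la : nat -> nat) (A : 'I_L -> int) :
  (\sum_(i < L) la i)%N = N -> (N <= D)%N ->
  \sum_(s : 'S_N) altchar L s la * permchar s A = (N`!)%:Z * kostka D la A.
Proof.
move=> laN ND; rewrite kostka_count mulr_sumr.
under eq_bigr => s _ do rewrite /altchar mulr_suml.
rewrite exchange_big /=; apply: eq_bigr => w _.
under eq_bigr => s _ do rewrite -mulrA.
rewrite -mulr_sumr mulrCA; congr (_ * _).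
under [LHS]eq_bigr => s _.
  rewrite (@permcharM _ _ _ fst snd pair N D) => [|//|//|[]//|//]; over.
rewrite exchange_big /= mulr_sumr; apply: eq_bigr => M.
move=> /andP[/forallP M1 _]; rewrite mulr1; apply: sum_permchar.
apply/eqP; rewrite -eqz_nat -laN; apply/eqP.
transitivity (\sum_(u < L) (\sum_(p | p.1 == u) (M p : nat))%N%:Z).
  rewrite (partition_big fst predT) //= -natz natr_sum.
  by apply: eq_bigr => u _; rewrite natz.
under eq_bigr => u _ do rewrite (eqP (M1 u)).
(* The total of the table is that of [la], since the terms w i - i cancel over all i. *)
rewrite sumrB big_split /= [X in _ + X - _](_ : _ = \sum_(i < L) i%:Z).
  by rewrite addrK -[RHS]natz natr_sum; apply: eq_bigr => i _; rewrite natz.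
by rewrite [RHS](reindex_inj (@perm_inj _ w)).
Qed.

End KostkaCount.

(** * Kronecker coefficients from Kostka numbers *)

Lemma partition_nth_le (s : seq nat) i j :
  is_partition s -> (i <= j)%N -> (nth 0 s j <= nth 0 s i)%N.
Proof.
move=> sP ij; have [js|js] := ltnP j (size s); last by rewrite nth_default.
have geq_trans : transitive geq by move=> y x z /= xy yz; exact: leq_trans yz xy.
have geq_refl : reflexive geq by move=> x /=.
by apply: (sorted_leq_nth geq_trans geq_refl 0%N sP) => //; rewrite inE // (leq_ltn_trans ij).
Qed.

Lemma partition_nth_eq0 (s : seq nat) i :
  is_partition s -> (sumn s <= i)%N -> nth 0%N s i = 0%N.
Proof.
elim: s i => [|x s IH] [|i] sP; rewrite ?nth_nil //=; first by lia.
have sP' : is_partition s := path_sorted sP.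
case: x sP => [|x] sP le; last by apply: IH => //; lia.
by have := partition_nth_le sP (leq0n i.+1); rewrite /=; lia.
Qed.

Lemma sum_nth_sumn (s : seq nat) L :
  (forall i, (L <= i)%N -> nth 0%N s i = 0%N) -> (\sum_(i < L) nth 0%N s i)%N = sumn s.
Proof.
move=> s0; rewrite sumnE (big_nth 0%N) big_mkord.
rewrite -(@sum_ord_widen _ (nth 0%N s) L (L + size s)) ?leq_addr //.
rewrite -(@sum_ord_widen _ (nth 0%N s) (size s) (L + size s)) ?leq_addl //.
by move=> d; exact: nth_default.
Qed.

Lemma chi_altchar_stable (N n : nat) (la : seq nat) (s : 'S_N) :
  is_partition la -> sumn la = N -> (forall i, (n <= i)%N -> nth 0%N la i = 0%N) ->
  chi la s = altchar n s (nth 0%N la).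
Proof.
move=> laP laN la0; rewrite chi_altchar.
(* N and n are not comparable in general, hence the passage through their maximum. *)
rewrite -(@altchar_stable N (maxn N n)) ?leq_maxl //; last first.
  by move=> i Ni; apply: partition_nth_eq0; rewrite ?laN.
by rewrite (@altchar_stable n) ?leq_maxr.
Qed.

Section KronFormula.
Variables (p q L : nat) (row : 'I_L -> 'I_p) (col : 'I_L -> 'I_q).
Variable cell : 'I_p -> 'I_q -> 'I_L.
Hypothesis row_cell : forall u v, row (cell u v) = u.
Hypothesis col_cell : forall u v, col (cell u v) = v.
Hypothesis cell_rc : forall x, cell (row x) (col x) = x.

Definition table (D : nat) (A : {ffun 'I_L -> 'I_D.+1}) (b : 'I_p -> int) (c : 'I_q -> int) :=
  [forall u, (\sum_(x | row x == u) (A x : nat))%N%:Z == b u] &&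
  [forall v, (\sum_(x | col x == v) (A x : nat))%N%:Z == c v].

(** Expand the characters of [mu] and [nu] only. Each product of permutation characters splits into
    permutation characters of tables, and pairing these with the character of [la] gives Kostka
    numbers. *)
Lemma kron_formula (la mu nu : seq nat) (D : nat) :
  is_partition la -> is_partition mu -> is_partition nu ->
  sumn mu = sumn la -> sumn nu = sumn la -> (sumn la <= D)%N ->
  (forall i, (L <= i)%N -> nth 0%N la i = 0%N) ->
  (forall i, (p <= i)%N -> nth 0%N mu i = 0%N) ->
  (forall i, (q <= i)%N -> nth 0%N nu i = 0%N) ->
  kron la mu nu = (\sum_(w : 'S_p) \sum_(w' : 'S_q) (-1) ^+ w * (-1) ^+ w' *
    \sum_(A : {ffun 'I_L -> 'I_D.+1} |
       table A (fun u => (nth 0%N mu u)%:Z + (w u)%:Z - u%:Z)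
               (fun v => (nth 0%N nu v)%:Z + (w' v)%:Z - v%:Z))
      kostka D (nth 0%N la) (fun x => (A x)%:Z))%:~R.
Proof.
move=> laP muP nuP muN nuN ND la0 mu0 nu0.
rewrite /kron laP muP nuP muN nuN !eqxx /=.
set N := sumn la; set S := (X in _ = X%:~R).
suff -> : \sum_(s : 'S_N) ((chi la s * chi mu s * chi nu s)%:~R : rat) = ((N`!)%:Z * S)%:~R.
  by rewrite rmorphM /= mulKf // pnatr_eq0 -lt0n fact_gt0.
rewrite -(rmorph_sum (intmul 1)) /=; congr (_%:~R).
under eq_bigr => s _.
  rewrite (@chi_altchar_stable N L) // (@chi_altchar_stable N p) //.
  rewrite (@chi_altchar_stable N q) // -mulrA.
  rewrite {2 3}/altchar big_distrlr /= mulr_sumr.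
  over.
rewrite exchange_big /= mulr_sumr; apply: eq_bigr => w _.
under eq_bigr do rewrite mulr_sumr.
rewrite exchange_big /= mulr_sumr; apply: eq_bigr => w' _.
under eq_bigr => s _.
  rewrite mulrACA (@permcharM _ _ _ row col cell N D) // mulrCA mulr_sumr.
  over.
rewrite -mulr_sumr [RHS]mulrCA; congr (_ * _).
rewrite exchange_big /= mulr_sumr; apply: eq_bigr => A _.
by apply: sum_altchar_permchar => //; exact: sum_nth_sumn.
Qed.

End KronFormula.

(** * Dominance and stabilization of Kostka numbers *)

Section PartialSums.
Variable L : nat.
Implicit Types (A B : 'I_L -> int) (w : 'S_L).

Definition psums A (j : nat) : int := \sum_(i < L | (i < j)%N) A i.

Lemma psumsD A B j : psums (fun i => A i + B i) j = psums A j + psums B j.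
Proof. exact: big_split. Qed.

Lemma psumsS A (j : 'I_L) : psums A j.+1 = psums A j + A j.
Proof.
rewrite /psums (bigD1 j) //= addrC; congr (_ + _); apply: eq_bigl => i.
by rewrite ltnS ltn_neqAle -val_eqE andbC.
Qed.

Lemma psums0 A : psums A 0 = 0.
Proof. by rewrite /psums big_pred0. Qed.

Lemma psumsT A j : (L <= j)%N -> psums A j = \sum_i A i.
Proof. by move=> Lj; apply: eq_bigl => i; rewrite (leq_trans (ltn_ord i)). Qed.

(** Compare with the positive part [g] of f - f(j): its total is invariant under [w], bounds the
    permuted sum from above, and is attained by the first j indices. *)
Lemma rearrangement (f : 'I_L -> int) w j :
  (forall x y : 'I_L, (x <= y)%N -> f y <= f x) ->
  psums (fun i => f (w i)) j <= psums f j.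
Proof.
move=> fdec; have [jL|Lj] := ltnP j L; last first.
  by rewrite !psumsT // [leRHS](reindex_inj (@perm_inj _ w)).
pose t := f (Ordinal jL); pose g (x : 'I_L) := if (x < j)%N then f x - t else 0.
have g0 x : 0 <= g x.
  by rewrite /g; case: ifP => // xj; rewrite subr_ge0 fdec // ltnW.
have fg x : f x - t <= g x.
  by rewrite /g; case: ltnP => // jx; rewrite subr_le0 fdec.
have : \sum_(i < L | (i < j)%N) (f (w i) - t) <= \sum_(i < L | (i < j)%N) (f i - t).
  apply: le_trans (_ : \sum_(i < L | (i < j)%N) g (w i) <= _); first exact: ler_sum.
  apply: le_trans (_ : \sum_i g (w i) <= _).
    by rewrite [leRHS](bigID (fun i : 'I_L => (i < j)%N)) /= lerDl sumr_ge0.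
  have -> : \sum_i g (w i) = \sum_i g i by rewrite [RHS](reindex_inj (@perm_inj _ w)).
  by rewrite -big_mkcond.
by rewrite !sumrB lerD2r.
Qed.

(** The contents occurring in the alternating sums. Partial sums never decrease under a shift, so
    shifting moves up in dominance order. *)
Definition shift A w : 'I_L -> int := fun i => A i + (w i)%:Z - i%:Z.

Lemma psums_shift A w j : psums A j <= psums (shift A w) j.
Proof.
rewrite (_ : psums (shift A w) j = psums A j + (psums (fun i => (w i)%:Z) j -
   psums (fun i : 'I_L => i%:Z) j)); last first.
  rewrite /psums -sumrB -big_split /=; apply: eq_bigr => i _.
  by rewrite /shift addrA.
rewrite lerDl subr_ge0 -lerN2.
have := @rearrangement (fun i => - i%:Z) w j.
rewrite /psums -!sumrN; apply => x y; lia.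
Qed.

Lemma shift1 A : shift A 1%g =1 A.
Proof. by move=> i; rewrite /shift perm1 addrK. Qed.

Lemma sum_shift A w : \sum_i shift A w i = \sum_i A i.
Proof.
rewrite /shift sumrB big_split /= -[RHS](addrK (\sum_(i < L) i%:Z)).
by congr (_ + _ - _); rewrite [RHS](reindex_inj (@perm_inj _ w)).
Qed.

Lemma psums_shift_eq A w :
  (forall j, (j <= L)%N -> psums (shift A w) j = psums A j) -> w = 1%g.
Proof.
move=> e; apply/permP=> i; rewrite perm1; apply: val_inj => /=.
have := e i.+1 (ltn_ord i); rewrite !psumsS e 1?ltnW // /shift.
by move/addrI; lia.
Qed.

(** A numerical measure of dominance: it is monotone in every partial sum and strictly increases
    under each nontrivial shift. *)
Definition height A : int := \sum_(j < L.+1) psums A j.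

Lemma height_shift A w : w != 1%g -> height A < height (shift A w).
Proof.
move=> w1; rewrite lt_neqAle ler_sum ?andbT; last by move=> j _; exact: psums_shift.
apply: contra w1 => /eqP e; apply/eqP/(@psums_shift_eq A) => j jL.
have /eqP : \sum_(j < L.+1) (psums (shift A w) j - psums A j) = 0.
  by rewrite sumrB -/(height _) -/(height _) e subrr.
rewrite psumr_eq0 => [/allP/(_ (Ordinal (jL : (j < L.+1)%N)))|i _]; last first.
  by rewrite subr_ge0 psums_shift.
by rewrite mem_index_enum subr_eq0 => /(_ isT) /eqP.
Qed.

Lemma height_le A : (forall i, 0 <= A i) -> height A <= (\sum_i A i) *+ L.+1.
Proof.
move=> A0; rewrite -[X in _ *+ X]card_ord -sumr_const; apply: ler_sum => j _.
by rewrite [leRHS](bigID (fun i : 'I_L => (i < j)%N)) /= lerDl sumr_ge0.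
Qed.

(* Shifting raises [height] while preserving the total, which bounds [height] on
   nonnegative vectors: the shift relation is well-founded there. *)
Lemma shift_ind (P : ('I_L -> int) -> Prop) :
  (forall A i, A i < 0 -> P A) ->
  (forall A, (forall i, 0 <= A i) -> (forall w, w != 1%g -> P (shift A w)) -> P A) ->
  forall A, P A.
Proof.
move=> Pneg Pstep A.
have [n] : exists n : nat, (\sum_i A i) *+ L.+1 - height A < n%:Z.
  exists `|(\sum_i A i) *+ L.+1 - height A|.+1; lia.
elim: n A => [|n IH] A lt.
  have [/forallP A0|] := boolP [forall i, 0 <= A i].
    by have := height_le A0; move: lt; rewrite subr_lt0 => /lt_le_trans h /h; rewrite ltxx.
  by rewrite negb_forall => /existsP[i]; rewrite -ltNge => /Pneg.
have [/forallP A0|] := boolP [forall i, 0 <= A i]; last first.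
  by rewrite negb_forall => /existsP[i]; rewrite -ltNge => /Pneg.
apply: Pstep => // w w1; apply: IH; rewrite sum_shift.
by have := height_shift A w1; lia.
Qed.

End PartialSums.

Section Kostka.
Variables (L : nat).

Lemma eq_kostka D la (A B : 'I_L -> int) : A =1 B -> kostka D la A = kostka D la B.
Proof.
move=> AB; rewrite /kostka.
have -> : [forall i, 0 <= A i] = [forall i, 0 <= B i].
  by apply: eq_forallb => i; rewrite AB.
by congr (if _ then _@_ _ else _); apply/mnmP=> i; rewrite !mnmE AB.
Qed.

Lemma kostka_neg D la (A : 'I_L -> int) i : A i < 0 -> kostka D la A = 0.
Proof.
move=> Ai; rewrite /kostka ifF //; apply/negbTE; rewrite negb_forall; apply/existsP.
by exists i; rewrite -ltNge.
Qed.

Variables (D : nat) (la : nat -> nat).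
Hypothesis la_dec : forall i j, (i <= j < L)%N -> (la j <= la i)%N.
Hypothesis laD : forall i, (i < L)%N -> (la i + L <= D)%N.

Let lav (i : 'I_L) : int := (la i)%:Z.

(** Isolate the identity permutation in [kostka_alt]. All Kostka numbers on the right belong to
    contents of larger height, so this supports induction by [shift_ind]. *)
Lemma kostka_rec (A : 'I_L -> int) : (forall i, 0 <= A i) ->
  kostka D la A = \sum_(w : 'S_L) (-1) ^+ w *
     ([forall i : 'I_L, A i + (L.-1 - i)%N%:Z == (la (w i) + (L.-1 - w i))%N%:Z])%:R
   - \sum_(w : 'S_L | w != 1%g) (-1) ^+ w * kostka D la (shift A w).
Proof.
move=> A0; have := kostka_alt (fun i => `|A i|%N) laD.
rewrite (bigD1 1%g) //= odd_perm1 expr0 mul1r => e.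
rewrite [X in X - _](_ : _ = \sum_(w : 'S_L) (-1) ^+ w *
     ([forall i : 'I_L, (`|A i| + (L.-1 - i) == la (w i) + (L.-1 - w i))%N])%:R); last first.
  apply: eq_bigr => w _; congr (_ * (nat_of_bool _)%:R); apply: eq_forallb => i.
  by have := A0 i; lia.
rewrite -{}e addrAC [X in X - _ + _](_ : _ = kostka D la A); last first.
  by apply: eq_kostka => i; rewrite perm1 gez0_abs // addrK.
rewrite -addrA [X in _ + X](_ : _ = 0) ?addr0 //.
rewrite addrC; apply/eqP; rewrite subr_eq0; apply/eqP; apply: eq_bigr => w _.
by congr (_ * _); apply: eq_kostka => i; rewrite gez0_abs.
Qed.

Lemma staircase_dec (x y : 'I_L) : (x <= y)%N ->
  (la y + (L.-1 - y))%N%:Z <= (la x + (L.-1 - x))%N%:Z.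
Proof. by move=> xy; have := @la_dec x y; rewrite xy ltn_ord => /(_ isT); lia. Qed.

(** A violation of dominance persists under shifts, so the recursive terms vanish by induction. An
    inhomogeneous term survives only if A + delta permutes la + delta, and then [rearrangement]
    yields dominance. *)
Lemma kostka_dom (A : 'I_L -> int) j : psums lav j < psums A j -> kostka D la A = 0.
Proof.
elim/shift_ind: A j => [A i Ai j _|A A0 IH j lt]; first exact: kostka_neg Ai.
rewrite kostka_rec // !big1 ?subr0 // => [w w1|w _].
  by rewrite (IH w w1 j) ?mulr0 // (lt_le_trans lt) // psums_shift.
case: forallP => [e|]; rewrite ?mulr0 //.
have := rearrangement w j staircase_dec.
have -> : psums (fun i : 'I_L => (la (w i) + (L.-1 - w i))%N%:Z) j =
   psums A j + psums (fun i : 'I_L => (L.-1 - i)%N%:Z) j.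
  by rewrite -psumsD; apply: eq_bigr => i _; rewrite -(eqP (e i)).
have -> : psums (fun i : 'I_L => (la i + (L.-1 - i))%N%:Z) j =
   psums lav j + psums (fun i : 'I_L => (L.-1 - i)%N%:Z) j.
  by rewrite -psumsD; apply: eq_bigr => i _; rewrite PoszD.
by rewrite lerD2r => /le_lt_trans/(_ lt); rewrite ltxx.
Qed.

(** Every nontrivial shift of [la] violates dominance, and la + delta is strictly decreasing, so
    only the identity term of [kostka_rec] remains. *)
Lemma kostka_diag : kostka D la lav = 1.
Proof.
rewrite kostka_rec // [X in _ - X]big1 ?subr0 => [|w w1]; last first.
  have [/existsP[j]|] := boolP [exists j : 'I_L.+1, psums lav j < psums (shift lav w) j].
    by move/kostka_dom ->; rewrite mulr0.
  rewrite negb_exists => /forallP h; case/eqP: w1; apply: (@psums_shift_eq _ lav) => j jL.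
  apply/eqP; rewrite eq_le psums_shift andbT leNgt.
  exact: (h (Ordinal (jL : (j < L.+1)%N))).
rewrite (bigD1 1%g) //= odd_perm1 expr0 mul1r big1 ?addr0 => [|w w1].
  by case: forallP => // [[]] i; rewrite perm1 PoszD.
case: forallP => [e|]; rewrite ?mulr0 //; case/eqP: w1; apply/permP=> i; rewrite perm1.
apply: val_inj; have := eqP (e i); rewrite /lav /= => {}e.
have := ltn_ord i; have := ltn_ord (w i).
case: (ltngtP i (w i)) => [lt|lt|->//] wL iL.
  by have := @la_dec i (w i); rewrite (ltnW lt) ltn_ord => /(_ isT); lia.
by have := @la_dec (w i) i; rewrite (ltnW lt) ltn_ord => /(_ isT); lia.
Qed.

End Kostka.

(** * Eventually constant sequences *)

Definition evconst (T : Type) (f : nat -> T) : Prop :=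
  exists c, exists K, forall k, (K <= k)%N -> f k = c.

Lemma evconst_cst (T : Type) (c : T) : evconst (fun=> c).
Proof. by exists c, 0%N. Qed.

Lemma evconst_eventually (T : Type) (f g : nat -> T) K :
  (forall k, (K <= k)%N -> f k = g k) -> evconst g -> evconst f.
Proof.
move=> fg [c [K' h]]; exists c, (maxn K K') => k; rewrite geq_max => /andP[k1 k2].
by rewrite fg // h.
Qed.

Lemma evconst_op (T U V : Type) (op : T -> U -> V) f g :
  evconst f -> evconst g -> evconst (fun k => op (f k) (g k)).
Proof.
move=> [c [K h]] [c' [K' h']]; exists (op c c'), (maxn K K') => k.
by rewrite geq_max => /andP[k1 k2]; rewrite h // h'.
Qed.

Lemma evconst_big (T I : Type) (op : T -> T -> T) (idx : T) (r : seq I) (P : pred I)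
    (F : I -> nat -> T) :
  (forall i, P i -> evconst (F i)) -> evconst (fun k => \big[op/idx]_(i <- r | P i) F i k).
Proof.
move=> h; elim: r => [|i r IH].
  by apply: (@evconst_eventually _ _ _ 0 _ (evconst_cst idx)) => k _; rewrite big_nil.
have [Pi|Pi] := boolP (P i).
  apply: (@evconst_eventually _ _ _ 0 _ (evconst_op op (h i Pi) IH)) => k _.
  by rewrite big_cons Pi.
by apply: (@evconst_eventually _ _ _ 0 _ IH) => k _; rewrite big_cons (negbTE Pi).
Qed.

Lemma evconst_forall (I : finType) (F : I -> nat -> bool) :
  (forall i, evconst (F i)) -> evconst (fun k => [forall i, F i k]).
Proof.
move=> h; apply: (@evconst_eventually _ _ _ 0 _
  (@evconst_big _ _ andb true (index_enum I) predT F (fun i _ => h i))) => k _.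
by rewrite big_andE.
Qed.

Lemma evconst_eq_affine (a b c d : int) : evconst (fun k : nat => a + k%:Z * b == c + k%:Z * d).
Proof.
have [->|bd] := eqVneq b d.
  by apply: (@evconst_eventually _ _ _ 0 _ (evconst_cst (a == c))) => k _; rewrite (inj_eq (addIr _)).
(* With different slopes, equality means k (b - d) = c - a, impossible once k exceeds the absolute
   value of c - a. *)
exists false, `|c - a|.+1 => k kK; apply/negbTE/eqP => e.
have : k%:Z * (b - d) = c - a by rewrite mulrBr; lia.
move=> /(congr1 absz); rewrite abszM absz_nat; have : (0 < `|b - d|)%N by lia.
by move: kK; clear; nia.
Qed.

(** Induction on the height gap between [al] and [B]. The multiples of [la] cancel in the dominance
    test, so a violation, in particular a negative gap, gives 0 for all k. Otherwise [kostka_rec]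
    applies for large k; its inhomogeneous terms test equality of affine functions of k, and its
    shifts reduce the gap. *)
Lemma evconst_kostka (L : nat) (al la D : nat -> nat) (B : 'I_L -> int) :
  (forall i j, (i <= j < L)%N -> (al j <= al i)%N) ->
  (forall i j, (i <= j < L)%N -> (la j <= la i)%N) ->
  (forall k i, (i < L)%N -> (al i + k * la i + L <= D k)%N) ->
  evconst (fun k => kostka (D k) (fun i => al i + k * la i)%N
                     (fun i => B i + k%:Z * (la i)%:Z)).
Proof.
move=> al_dec la_dec Dk.
have dec k : forall i j, (i <= j < L)%N -> (al j + k * la j <= al i + k * la i)%N.
  by move=> i j ij; rewrite leq_add ?al_dec // leq_mul2l la_dec // orbT.
pose alv (i : 'I_L) := (al i)%:Z.
have vanish B' j : psums alv j < psums B' j ->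
    evconst (fun k => kostka (D k) (fun i => al i + k * la i)%N
                     (fun i : 'I_L => B' i + k%:Z * (la i)%:Z)).
  move=> lt; exists 0, 0%N => k _; apply: (@kostka_dom _ _ _ (dec k) (Dk k) _ j).
  have -> : psums (fun i : 'I_L => (al i + k * la i)%N%:Z) j =
      psums alv j + psums (fun i : 'I_L => k%:Z * (la i)%:Z) j.
    by rewrite -psumsD /psums; apply: eq_bigr => i _; rewrite PoszD PoszM.
  by rewrite psumsD ltrD2r.
have [n] : exists n : nat, height alv - height B < n%:Z.
  by exists `|height alv - height B|.+1; lia.
elim: n B => [|n IH] B lt.
  have [/existsP[j /vanish//]|] := boolP [exists j : 'I_L.+1, psums alv j < psums B j].
  rewrite negb_exists => /forallP h; have : height B <= height alv.
    by apply: ler_sum => j _; rewrite leNgt.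
  by lia.
have [/existsP[i /andP[/eqP la0 Bi]]|] := boolP [exists i : 'I_L, (la i == 0%N) && (B i < 0)].
  by exists 0, 0%N => k _; apply: (@kostka_neg _ _ _ _ i); rewrite la0 mulr0 addr0.
rewrite negb_exists => /forallP nn.
(* Where [B] is negative the part of [la] is now at least 1, so from this [K] on all entries are
   nonnegative. *)
pose K := (\sum_i `|B i|)%N.
have nonneg k : (K <= k)%N -> forall i, 0 <= B i + k%:Z * (la i)%:Z.
  move=> Kk i; have := nn i; rewrite negb_and -leNgt => /orP[la0|Bi].
    have : (`|B i| <= k)%N by apply: leq_trans Kk; rewrite /K (bigD1 i) //= leq_addr.
    by move: la0; case: (la i) => // l _; clear; nia.
  by rewrite addr_ge0.
apply: (@evconst_eventually _ _ _ K (fun k Kk => kostka_rec (Dk k) (nonneg k Kk))).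
apply: (@evconst_op _ _ _ (fun x y : int => x - y)); apply: evconst_big => w w1;
  apply: (@evconst_op _ _ _ *%R (fun=> (-1) ^+ w) _ (evconst_cst _)).
  (* The constant [tt] reduces the binary [evconst_op] to a unary operation. *)
  apply: (@evconst_op _ _ _ (fun (b : bool) (_ : unit) => b%:R) _ _ _ (evconst_cst tt)).
  apply: evconst_forall => i.
  apply: (@evconst_eventually _ _ _ 0 _ (evconst_eq_affine
      (B i + (L.-1 - i)%N%:Z) (la i)%:Z ((al (w i) + (L.-1 - w i))%N%:Z) (la (w i))%:Z)) => k _.
  by congr (_ == _); lia.
have shE k : shift (fun i => B i + k%:Z * (la i)%:Z) w =1
    (fun i => shift B w i + k%:Z * (la i)%:Z) by move=> i; rewrite /shift; ring.
apply: (@evconst_eventually _ _ _ 0 (fun k _ => eq_kostka _ _ (shE k))).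
by apply: IH; have := height_shift B w1; lia.
Qed.

(** * Additive tables *)

Section Abel.
Variable L : nat.
Implicit Types (A B c : 'I_L -> int).

(** Summation by parts writes the cost difference as a sum of gaps between partial sums weighted by
    increments of [c]. These increments are integers, hence at least 1, and the unweighted gaps add
    up to the height difference. *)
Lemma abel c A B :
  (forall i j : 'I_L, (i < j)%N -> c i < c j) ->
  (forall j, psums B j <= psums A j) -> \sum_i B i = \sum_i A i ->
  height A - height B <= \sum_i c i * B i - \sum_i c i * A i.
Proof.
move=> cinc dom tot.
pose E j := psums A j - psums B j.
pose C k := oapp c 0 (insub k : option 'I_L).
have CE (i : 'I_L) : C i = c i by rewrite /C valK.
have E0 j : 0 <= E j by rewrite subr_ge0.
(* The boundary term vanishes at n = 0, where the junk index [n.-1] is harmless because E 0 = 0, and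
   at n = L, because the totals agree. *)
have step (n : nat) : (n <= L)%N ->
    \sum_(j < n) E j <= \sum_(i < n) C i * (E i - E i.+1) + E n * C n.-1.
  elim: n => [|n IH] nL; first by rewrite !big_ord0 /E !psums0 subrr mul0r addr0.
  rewrite !big_ord_recr /=.
  suff h : E n * C n.-1 + E n <= C n * E n.
    by have := IH (ltnW nL); set S := \sum_(_ < _) _; set S' := \sum_(_ < _) _; lra.
  case: n nL {IH} => [|n] nL /=; first by rewrite /E !psums0 subrr !(mul0r, mulr0) addr0.
  have := @cinc (Ordinal (ltnW nL)) (Ordinal nL) (ltnSn n).
  rewrite -!CE /= -lezD1 => /(ler_wpM2l (E0 n.+1)).
  by rewrite mulrDr mulr1 [_ * C n.+1]mulrC.
have EL : E L = 0 by rewrite /E !psumsT // tot subrr.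
have := step L (leqnn L); rewrite EL mul0r addr0.
rewrite (_ : \sum_(j < L) E j = height A - height B); last first.
  by rewrite /height -sumrB big_ord_recr /= -/(E L) EL addr0.
move/le_trans; apply; rewrite -sumrB le_eqVlt; apply/orP; left; apply/eqP.
apply: eq_bigr => i _; rewrite /E !psumsS CE; ring.
Qed.

Lemma height_eq A B :
  (forall j, psums B j <= psums A j) -> height A <= height B -> A =1 B.
Proof.
move=> dom le i.
have e j : (j <= L)%N -> psums A j = psums B j.
  move=> jL; have : \sum_(j < L.+1) (psums A j - psums B j) == 0.
    rewrite eq_le sumr_ge0 ?andbT; last by move=> k _; rewrite subr_ge0.
    by rewrite sumrB subr_le0.
  rewrite psumr_eq0 => [/allP/(_ (Ordinal (jL : (j < L.+1)%N)))|k _]; last first.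
    by rewrite subr_ge0.
  by rewrite mem_index_enum subr_eq0 => /(_ isT) /eqP.
by have := e i.+1 (ltn_ord i); rewrite !psumsS e 1?ltnW // => /addrI.
Qed.

(** Summation by parts between the zero vector and its shift by [w]: the cost falls by at least the
    rise in height, which is positive unless w = 1. *)
Lemma cost_shift c (w : 'S_L) : (forall i j : 'I_L, (i < j)%N -> c i < c j) ->
  \sum_i c i * ((w i)%:Z - i%:Z) <= 0 ?= iff (w == 1%g).
Proof.
move=> cinc; pose z (i : 'I_L) : int := 0.
have dom j : psums z j <= psums (shift z w) j by exact: psums_shift.
have := abel cinc dom; rewrite sum_shift => /(_ erefl).
rewrite [\sum_i c i * z i]big1 => [|i _]; last by rewrite mulr0.
rewrite sub0r (eq_bigr (fun i => c i * ((w i)%:Z - i%:Z))); last first.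
  by move=> i _; rewrite /shift add0r.
move=> le; have [->|w1] := eqVneq w 1%g.
  by apply/leifP; rewrite big1 // => i _; rewrite perm1 subrr mulr0.
by apply/leifP; have := height_shift z w1; lia.
Qed.

End Abel.

(** Both sides are the sum of [G] over all integer vectors, since each box contains the support of
    [G]. This exchanges a box growing with k for one of fixed size. *)
Lemma sum_box (L : nat) (G : ('I_L -> int) -> int) (lo lo' : 'I_L -> int) (D D' : nat) :
  (forall y z, y =1 z -> G y = G z) ->
  (forall z, G z != 0 -> forall x, lo x <= z x <= lo x + D%:Z) ->
  (forall z, G z != 0 -> forall x, lo' x <= z x <= lo' x + D'%:Z) ->
  \sum_(b : {ffun 'I_L -> 'I_D.+1}) G (fun x => lo x + (b x)%:Z) =
  \sum_(b : {ffun 'I_L -> 'I_D'.+1}) G (fun x => lo' x + (b x)%:Z).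
Proof.
move=> Gext.
(* Each point of one box with nonzero value is matched with its unique copy in the other box;
   exchanging the two sums then gives the symmetric expression. *)
have half (mo mo' : 'I_L -> int) (E E' : nat) :
  (forall z, G z != 0 -> forall x, mo' x <= z x <= mo' x + E'%:Z) ->
  \sum_(b : {ffun 'I_L -> 'I_E.+1}) G (fun x => mo x + (b x)%:Z) =
  \sum_(b : {ffun 'I_L -> 'I_E.+1}) \sum_(b' : {ffun 'I_L -> 'I_E'.+1} |
     [forall x, mo x + (b x)%:Z == mo' x + (b' x)%:Z]) G (fun x => mo x + (b x)%:Z).
  move=> box; apply: eq_bigr => b _.
  have [->|nz] := eqVneq (G (fun x => mo x + (b x)%:Z)) 0; first by rewrite big1.
  pose b' : {ffun 'I_L -> 'I_E'.+1} := [ffun x => inord (absz (mo x + (b x)%:Z - mo' x)%R)].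
  have b'E x : mo' x + (b' x)%:Z = mo x + (b x)%:Z.
    by have bx := box _ nz x; rewrite ffunE inordK; lia.
  rewrite (big_pred1 b') // => d; apply/forallP/eqP => [e|-> x]; last by rewrite b'E.
  apply/ffunP=> x; apply: val_inj; have := b'E x; rewrite (eqP (e x)) => /addrI []; exact: esym.
move=> box box'; rewrite (half _ lo' _ D') // (half lo' lo D' D) //.
rewrite (exchange_big_dep predT) //=; apply: eq_bigr => b _.
apply: eq_big => [b'|b' /forallP e]; first by apply: eq_forallb => x; rewrite eq_sym.
by apply: Gext => x; rewrite (eqP (e x)).
Qed.

Lemma partition_dec (s : seq nat) L : is_partition s ->
  forall i j, (i <= j < L)%N -> (nth 0%N s j <= nth 0%N s i)%N.
Proof. by move=> sP i j /andP[ij _]; exact: partition_nth_le. Qed.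

Lemma nth_le_sumn (s : seq nat) i : (nth 0%N s i <= sumn s)%N.
Proof.
elim: s i => [|x s IH] [|i] //=; first exact: leq_addr.
exact: leq_trans (IH i) (leq_addl _ _).
Qed.

Lemma natz_sum (I : Type) (r : seq I) (P : pred I) (F : I -> nat) :
  (\sum_(i <- r | P i) F i)%N%:Z = \sum_(i <- r | P i) (F i)%:Z.
Proof. exact: (big_morph Posz PoszD (erefl _)). Qed.

Lemma eq_kostka_shape L D (la la' : nat -> nat) (A : 'I_L -> int) :
  la =1 la' -> kostka D la A = kostka D la' A.
Proof.
move=> e; rewrite /kostka; case: ifP => // _; congr (_@_ _).
by rewrite /schur; congr (\det _); apply/matrixP=> i j; rewrite !mxE e.
Qed.

Lemma kron_neq0 la mu nu : kron la mu nu != 0 ->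
  [/\ is_partition la, is_partition mu, is_partition nu, sumn mu = sumn la & sumn nu = sumn la].
Proof.
rewrite /kron; case: ifP => [/and5P[-> -> -> /eqP -> /eqP ->]//|].
by rewrite eqxx.
Qed.

(** * Kronecker coefficients of additive tables *)

Section AdditiveTables.
Variables (p q L : nat) (row : 'I_L -> 'I_p) (col : 'I_L -> 'I_q).
Variable cell : 'I_p -> 'I_q -> 'I_L.
Hypothesis row_cell : forall u v, row (cell u v) = u.
Hypothesis col_cell : forall u v, col (cell u v) = v.
Hypothesis cell_rc : forall x, cell (row x) (col x) = x.
Variables (X : 'I_p -> int) (Y : 'I_q -> int).

Definition cost (x : 'I_L) : int := X (row x) + Y (col x).
Hypothesis cost_inc : forall x y : 'I_L, (x < y)%N -> cost x < cost y.

(** Unlike [table], this allows negative entries, which occur in differences of tables. *)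
Definition tableZ (z : 'I_L -> int) (b : 'I_p -> int) (c : 'I_q -> int) :=
  [forall u, \sum_(x | row x == u) z x == b u] &&
  [forall v, \sum_(x | col x == v) z x == c v].

Lemma tableZP z b c : reflect ((forall u, \sum_(x | row x == u) z x = b u) /\
  (forall v, \sum_(x | col x == v) z x = c v)) (tableZ z b c).
Proof.
by apply: (iffP andP) => -[h h']; split; try (apply/forallP=> x; apply/eqP);
  try (move=> x; apply/eqP; move: x; apply/forallP).
Qed.

Lemma table_tableZ D (A : {ffun 'I_L -> 'I_D.+1}) b c :
  table row col A b c = tableZ (fun x => (A x)%:Z) b c.
Proof. by congr (_ && _); apply: eq_forallb => u; rewrite natz_sum. Qed.

Lemma eq_tableZ z z' b b' c c' : z =1 z' -> b =1 b' -> c =1 c' ->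
  tableZ z b c = tableZ z' b' c'.
Proof.
move=> zz bb cc; congr (_ && _); apply: eq_forallb => u; rewrite ?bb ?cc;
  by congr (_ == _); apply: eq_bigr => x _; rewrite zz.
Qed.

Lemma tableZD z z' b b' c c' : tableZ z' b' c' ->
  tableZ (fun x => z x + z' x) (fun u => b u + b' u) (fun v => c v + c' v) = tableZ z b c.
Proof.
case/tableZP=> hb hc; congr (_ && _); apply: eq_forallb => u.
  by rewrite big_split /= hb (inj_eq (addIr _)).
by rewrite big_split /= hc (inj_eq (addIr _)).
Qed.

Lemma tableZ_sum_row z b c : tableZ z b c -> \sum_x z x = \sum_u b u.
Proof.
case/tableZP=> hb _; rewrite (partition_big row predT) //=.
by apply: eq_bigr => u _; rewrite -hb.
Qed.

Lemma tableZ_sum_col z b c : tableZ z b c -> \sum_x z x = \sum_v c v.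
Proof.
case/tableZP=> _ hc; rewrite (partition_big col predT) //=.
by apply: eq_bigr => u _; rewrite -hc.
Qed.

Lemma tableZ_cost z b c : tableZ z b c ->
  \sum_x cost x * z x = \sum_u X u * b u + \sum_v Y v * c v.
Proof.
case/tableZP=> hb hc; under eq_bigr do rewrite /cost mulrDl.
rewrite big_split /= (partition_big row predT) //= [X in _ + X = _](partition_big col predT) //=.
by congr (_ + _); apply: eq_bigr => u _; rewrite -?hb -?hc mulr_sumr;
  apply: eq_bigr => x /eqP ->.
Qed.

Lemma kostka_cost D (la : nat -> nat) z b c :
  (forall i j, (i <= j < L)%N -> (la j <= la i)%N) ->
  (forall i, (i < L)%N -> (la i + L <= D)%N) ->
  tableZ z b c -> \sum_u b u = \sum_(x < L) (la x)%:Z -> kostka D la z != 0 ->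
  let lav (x : 'I_L) := (la x)%:Z in
  (forall j, psums z j <= psums lav j) /\
  height lav - height z <= \sum_u X u * b u + \sum_v Y v * c v - \sum_x cost x * lav x.
Proof.
move=> ladec laD tb sb nz lav.
have dom j : psums z j <= psums lav j.
  by rewrite leNgt; apply: contra nz => lt; apply/eqP; exact: (kostka_dom ladec laD lt).
split=> //; rewrite -(tableZ_cost tb); apply: abel => //.
by rewrite (tableZ_sum_row tb).
Qed.

Lemma sum_perm_shift n (w : 'S_n) (f : 'I_n -> int) :
  \sum_u (f u + (w u)%:Z - u%:Z) = \sum_u f u.
Proof. exact: (sum_shift f w). Qed.

Lemma dot_shift n (c f : 'I_n -> int) (w : 'S_n) :
  \sum_u c u * (f u + (w u)%:Z - u%:Z) = \sum_u c u * f u + \sum_u c u * ((w u)%:Z - u%:Z).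
Proof. by rewrite -big_split /=; apply: eq_bigr => u _; rewrite -mulrDr addrA. Qed.

Definition zvec (n : nat) (s : seq nat) (u : 'I_n) : int := (nth 0%N s u)%:Z.
Definition tail0 (n : nat) (s : seq nat) := forall i, (n <= i)%N -> nth 0%N s i = 0%N.

Lemma sum_zvec n s : tail0 n s -> \sum_u @zvec n s u = (sumn s)%:Z.
Proof. by move=> s0; rewrite -natz_sum sum_nth_sumn. Qed.

Section Strict.
Hypothesis X_inc : forall u u' : 'I_p, (u < u')%N -> X u < X u'.
Hypothesis Y_inc : forall v v' : 'I_q, (v < v')%N -> Y v < Y v'.

Variables (la mu nu : seq nat).
Hypothesis la0 : tail0 L la.
Hypothesis mu0 : tail0 p mu.
Hypothesis nu0 : tail0 q nu.

(** The cost of [la] falls short of S by at least three nonnegative deficits: one from permuting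
    rows, one from permuting columns, one from the height gap of [z]. Equality forces all three to
    vanish. *)
Lemma kostka_extremal D (w : 'S_p) (w' : 'S_q) z :
  is_partition la -> sumn mu = sumn la ->
  (forall i, (i < L)%N -> (nth 0%N la i + L <= D)%N) ->
  tableZ z (shift (zvec mu) w) (shift (zvec nu) w') ->
  kostka D (nth 0%N la) z != 0 ->
  let S := \sum_u X u * zvec mu u + \sum_v Y v * zvec nu v in
  \sum_x cost x * zvec la x <= S /\
  (\sum_x cost x * zvec la x = S -> [/\ w = 1%g, w' = 1%g & z =1 zvec la]).
Proof.
move=> laP muN laD tb kz S.
have sb : \sum_u shift (zvec mu) w u = \sum_x @zvec L la x.
  by rewrite sum_perm_shift !sum_zvec ?muN.
have [dom bound] : (forall j, psums z j <= psums (@zvec L la) j) /\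
    height (@zvec L la) - height z <=
    \sum_u X u * (zvec mu u + (w u)%:Z - u%:Z) + \sum_v Y v * (zvec nu v + (w' v)%:Z - v%:Z)
    - \sum_x cost x * zvec la x := kostka_cost (partition_dec laP) laD tb sb kz.
rewrite !dot_shift in bound.
have [lX eX] := cost_shift w X_inc; have [lY eY] := cost_shift w' Y_inc.
have hle : height z <= height (@zvec L la) by apply: ler_sum => j _; exact: dom.
split=> [|e]; first by rewrite /S; lia.
rewrite /S in e; split.
- by apply/eqP; rewrite -eX; lia.
- by apply/eqP; rewrite -eY; lia.
by apply: fsym; apply: height_eq => //; lia.
Qed.

(** A nonzero coefficient has a nonzero term in [kron_formula], to which [kostka_extremal] applies;
    in the equality case the table of that term is [la] itself. *)
Lemma kron_cost : kron la mu nu != 0 ->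
  \sum_x cost x * zvec la x <= \sum_u X u * zvec mu u + \sum_v Y v * zvec nu v
    ?= iff tableZ (@zvec L la) (@zvec p mu) (@zvec q nu).
Proof.
move=> nz; have [laP muP nuP muN nuN] := kron_neq0 nz.
pose D := (sumn la + L)%N.
have laD i : (i < L)%N -> (nth 0%N la i + L <= D)%N by rewrite leq_add2r nth_le_sumn.
have [w [w' [A [tb kz]]]] : exists (w : 'S_p) (w' : 'S_q), exists A : {ffun 'I_L -> 'I_D.+1},
    tableZ (fun x => (A x)%:Z) (shift (zvec mu) w) (shift (zvec nu) w') /\
    kostka D (nth 0%N la) (fun x => (A x)%:Z) != 0.
  have [/existsP[w /existsP[w' /existsP[A /andP[t k]]]]|ne] := boolP
    [exists w : 'S_p, exists w' : 'S_q, exists A : {ffun 'I_L -> 'I_D.+1},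
    tableZ (fun x => (A x)%:Z) (shift (zvec mu) w) (shift (zvec nu) w') &&
    (kostka D (nth 0%N la) (fun x => (A x)%:Z) != 0)]; first by exists w, w', A.
  case/eqP: nz.
  rewrite (kron_formula row_cell col_cell cell_rc (D := D)) ?leq_addr //.
  rewrite big1 // => w _; rewrite big1 // => w' _; rewrite big1 ?mulr0 // => A tb.
  apply/eqP; apply: contraNT ne => kz.
  by apply/existsP; exists w; apply/existsP; exists w'; apply/existsP; exists A;
    rewrite kz andbT -table_tableZ.
have [le ext] := kostka_extremal laP muN laD tb kz.
apply/leifP; case: ifP => tL; first by rewrite -(tableZ_cost tL).
rewrite lt_neqAle le andbT; apply/eqP => /ext[w1 w'1 AE].
move/negP: tL; apply; move: tb; rewrite w1 w'1.
by rewrite (eq_tableZ AE (shift1 _) (shift1 _)).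
Qed.

(** When [la] is a table with these margins the cost bound is attained, so only the identity
    permutations and the table [la] contribute, with value [kostka_diag]. *)
Lemma kron_table : is_partition la -> is_partition mu -> is_partition nu ->
  tableZ (@zvec L la) (@zvec p mu) (@zvec q nu) -> kron la mu nu = 1.
Proof.
move=> laP muP nuP tL.
have muN : sumn mu = sumn la.
  by apply/eqP; rewrite -eqz_nat -(sum_zvec mu0) -(sum_zvec la0) (tableZ_sum_row tL).
have nuN : sumn nu = sumn la.
  by apply/eqP; rewrite -eqz_nat -(sum_zvec nu0) -(sum_zvec la0) (tableZ_sum_col tL).
pose D := (sumn la + L)%N.
have laD i : (i < L)%N -> (nth 0%N la i + L <= D)%N by rewrite leq_add2r nth_le_sumn.
have ext w w' z := @kostka_extremal D w w' z laP muN laD.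
have eS := tableZ_cost tL.
rewrite (kron_formula row_cell col_cell cell_rc (D := D)) ?leq_addr //.
rewrite -[1]/(1%:~R); congr (_%:~R).
have zero w w' (A : {ffun 'I_L -> 'I_D.+1}) :
    table row col A (shift (zvec mu) w) (shift (zvec nu) w') ->
    ~ [/\ w = 1%g, w' = 1%g & (fun x => (A x)%:Z) =1 zvec la] ->
    kostka D (nth 0%N la) (fun x => (A x)%:Z) = 0.
  rewrite table_tableZ => tb ne; apply/eqP; apply: contra_notT ne => kz.
  by have [_ /(_ eS)] := ext _ _ _ tb kz.
rewrite (bigD1 1%g) //= [X in _ + X]big1 ?addr0 => [|w w1]; last first.
  rewrite big1 // => w' _; rewrite big1 ?mulr0 // => A tb; apply: zero tb _.
  by case=> e; rewrite e eqxx in w1.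
rewrite (bigD1 1%g) //= [X in _ + X]big1 ?addr0 => [|w w1]; last first.
  rewrite big1 ?mulr0 // => A tb; apply: zero tb _.
  by case=> _ e; rewrite e eqxx in w1.
rewrite !odd_perm1 !expr0 !mul1r.
pose A0 : {ffun 'I_L -> 'I_D.+1} := [ffun x : 'I_L => inord (nth 0%N la x)].
have A0E x : (A0 x)%:Z = zvec la x.
  by rewrite ffunE inordK // ltnS (leq_trans (nth_le_sumn _ _)) ?leq_addr.
rewrite (bigD1 A0) /=; last first.
  rewrite table_tableZ (eq_tableZ A0E (b' := zvec mu) (c' := zvec nu)) //.
    exact: (shift1 (zvec mu)).
  exact: (shift1 (zvec nu)).
rewrite (eq_kostka _ _ A0E) (kostka_diag (partition_dec laP) laD) big1 ?addr0 // => A /andP[tb nA].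
apply: zero tb _; case=> _ _ AE; case/eqP: nA; apply/ffunP=> x; apply: val_inj.
by have := AE x; rewrite -A0E => -[].
Qed.

End Strict.

Lemma nth_padd s t i : nth 0%N (padd s t) i = (nth 0%N s i + nth 0%N t i)%N.
Proof.
rewrite /padd; have [lt|ge] := ltnP i (maxn (size s) (size t)); first by rewrite nth_mkseq.
rewrite nth_default ?size_mkseq //; move: ge; rewrite geq_max => /andP[h1 h2].
by rewrite !nth_default.
Qed.

Lemma nth_pscale k s i : nth 0%N (pscale k s) i = (k * nth 0%N s i)%N.
Proof.
have [lt|ge] := ltnP i (size s); first by rewrite (nth_map 0%N).
by rewrite !nth_default ?size_map // muln0.
Qed.

Lemma is_partitionP s :
  reflect (forall i, (nth 0%N s i.+1 <= nth 0%N s i)%N) (is_partition s).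
Proof.
apply: (iffP idP) => [sP i|h]; first by apply: partition_nth_le.
by apply/(sortedP 0%N) => i _; exact: h.
Qed.

Lemma is_partition_padd s t : is_partition s -> is_partition t -> is_partition (padd s t).
Proof.
move=> /is_partitionP sP /is_partitionP tP; apply/is_partitionP => i.
by rewrite !nth_padd leq_add.
Qed.

Lemma is_partition_pscale k s : is_partition s -> is_partition (pscale k s).
Proof.
by move=> /is_partitionP sP; apply/is_partitionP => i; rewrite !nth_pscale leq_mul2l sP orbT.
Qed.

Lemma sumn_pscale k s : sumn (pscale k s) = (k * sumn s)%N.
Proof. by elim: s => [|x s /= ->]; rewrite ?muln0 // mulnDr. Qed.

Lemma sumn_padd s t : sumn (padd s t) = (sumn s + sumn t)%N.
Proof.
pose n := maxn (size s) (size t).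
rewrite -(@sum_nth_sumn (padd s t) n) -?(@sum_nth_sumn s n) -?(@sum_nth_sumn t n).
- by rewrite -big_split; apply: eq_bigr => i _; rewrite nth_padd.
- by move=> i ni; rewrite nth_default // (leq_trans _ ni) // leq_maxr.
- by move=> i ni; rewrite nth_default // (leq_trans _ ni) // leq_maxl.
by move=> i ni; rewrite nth_default // size_mkseq.
Qed.


(** An entry is a difference of consecutive partial sums, and each gap between partial sums lies
    between 0 and the height gap. *)
Lemma psums_diff_le (A B : 'I_L -> int) (x : 'I_L) :
  (forall j, psums B j <= psums A j) ->
  - (height A - height B) <= B x - A x <= height A - height B.
Proof.
move=> dom.
have le j : (j <= L)%N -> psums A j - psums B j <= height A - height B.
  move=> jL; rewrite /height -[leRHS]sumrB (bigD1 (Ordinal (jL : (j < L.+1)%N))) //= lerDl.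
  by apply: sumr_ge0 => i _; rewrite subr_ge0.
have := le x.+1 (ltn_ord x); have := le x (ltnW (ltn_ord x)).
by have := dom x.+1; have := dom x; rewrite !psumsS; lia.
Qed.

Lemma kron_stable (la mu nu al be ga : seq nat) :
  is_partition la -> is_partition mu -> is_partition nu ->
  is_partition al -> is_partition be -> is_partition ga ->
  tail0 L la -> tail0 p mu -> tail0 q nu -> tail0 L al -> tail0 p be -> tail0 q ga ->
  tableZ (@zvec L la) (@zvec p mu) (@zvec q nu) ->
  evconst (fun k => kron (padd al (pscale k la)) (padd be (pscale k mu)) (padd ga (pscale k nu))).
Proof.
move=> laP muP nuP alP beP gaP la0 mu0 nu0 al0 be0 ga0 tL.
have muN : sumn mu = sumn la.
  by apply/eqP; rewrite -eqz_nat -(sum_zvec mu0) -(sum_zvec la0) (tableZ_sum_row tL).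
have nuN : sumn nu = sumn la.
  by apply/eqP; rewrite -eqz_nat -(sum_zvec nu0) -(sum_zvec la0) (tableZ_sum_col tL).
have sE s t k : sumn (padd s (pscale k t)) = (sumn s + k * sumn t)%N.
  by rewrite sumn_padd sumn_pscale.
have nE s t k i : nth 0%N (padd s (pscale k t)) i = (nth 0%N s i + k * nth 0%N t i)%N.
  by rewrite nth_padd nth_pscale.
(* If the sizes of [al], [be], [ga] are not all equal, adding multiples of equal sizes keeps them
   so, and every coefficient is 0. *)
have [/andP[/eqP beN /eqP gaN]|ne] := boolP ((sumn be == sumn al) && (sumn ga == sumn al));
    last first.
  exists 0, 0%N => k _; rewrite /kron !sE muN nuN !eqn_add2r ifF //.
  by apply/negbTE; move: ne; apply: contra => /and5P[_ _ _ -> ->].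
pose D k := (sumn al + k * sumn la + L)%N.
pose f k i := (nth 0%N al i + k * nth 0%N la i)%N.
have fdec k i j : (i <= j < L)%N -> (f k j <= f k i)%N.
  move=> ij; rewrite /f leq_add ?(partition_dec alP ij) // leq_mul2l (partition_dec laP ij).
  by rewrite orbT.
have fD k i : (i < L)%N -> (f k i + L <= D k)%N.
  move=> _; rewrite /D leq_add2r leq_add ?nth_le_sumn // leq_mul2l nth_le_sumn orbT.
  by [].
have fN k : \sum_(x < L) (f k x)%:Z = (sumn al + k * sumn la)%N%:Z.
  by rewrite -natz_sum big_split /= -big_distrr /= !sum_nth_sumn.
have tails s t k n : tail0 n s -> tail0 n t -> tail0 n (padd s (pscale k t)).
  by move=> s0 t0 i ni; rewrite nE s0 // t0 // muln0.
apply: (@evconst_eventually _ _ _ 0 (fun k _ => kron_formula row_cell col_cell cell_rc (D := D k)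
  (is_partition_padd alP (is_partition_pscale k laP))
  (is_partition_padd beP (is_partition_pscale k muP))
  (is_partition_padd gaP (is_partition_pscale k nuP)) _ _ _
  (tails _ _ k _ al0 la0) (tails _ _ k _ be0 mu0) (tails _ _ k _ ga0 nu0))).
- by move=> k _; rewrite !sE beN muN.
- by move=> k _; rewrite !sE gaN nuN.
- by move=> k _; rewrite sE /D leq_addr.
apply: (@evconst_op _ _ _ (fun (z : int) (_ : unit) => z%:~R) _ _ _ (evconst_cst tt)).
apply: evconst_big => w _; apply: evconst_big => w' _.
apply: (@evconst_op _ _ _ *%R (fun=> (-1) ^+ w * (-1) ^+ w') _ (evconst_cst _)).
(* [G k z] is the contribution of the table z; its margin condition is put on z - k la so that it
   reads the same for every k. *)
pose G k (z : 'I_L -> int) : int :=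
  if tableZ (fun x => z x - k%:Z * zvec la x) (shift (zvec be) w) (shift (zvec ga) w')
  then kostka (D k) (f k) z else 0.
(* [kap] bounds the height gap between al + k la and a contributing table. The terms in k cancel
   because k la has margins k mu and k nu, so neither [kap] nor the radius [Q] depends on k. *)
pose kap := \sum_u X u * shift (zvec be) w u + \sum_v Y v * shift (zvec ga) w' v
  - \sum_x cost x * zvec al x.
pose Q := (`|kap| + sumn al)%N.
have Gext k y z : y =1 z -> G k y = G k z.
  move=> yz; rewrite /G (eq_kostka _ _ yz); congr (if _ then _ else _).
  by apply: eq_tableZ => // x; rewrite yz.
have tscale k : tableZ (fun x => k%:Z * zvec la x) (fun u => k%:Z * zvec mu u)
    (fun v => k%:Z * zvec nu v).
  case/tableZP: tL => hb hc; apply/tableZP; split=> u; rewrite -mulr_sumr.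
    by rewrite hb.
  by rewrite hc.
have tG k z : tableZ (fun x => z x - k%:Z * zvec la x) (shift (zvec be) w) (shift (zvec ga) w')
   = tableZ z (shift (zvec (padd be (pscale k mu))) w) (shift (zvec (padd ga (pscale k nu))) w').
  rewrite -(tableZD _ _ _ (tscale k)); apply: eq_tableZ => u.
  - by rewrite subrK.
  - by rewrite /shift /zvec nE PoszD PoszM; ring.
  by rewrite /shift /zvec nE PoszD PoszM; ring.
have Gsum k z : G k z != 0 -> (forall x, 0 <= z x) /\ \sum_x z x = (sumn al + k * sumn la)%N%:Z.
  rewrite /G tG; case: ifP => [tb nz|]; last by rewrite eqxx.
  split=> [x|]; first by rewrite leNgt; apply: contra nz => h; apply/eqP; exact: kostka_neg h.
  rewrite (tableZ_sum_row tb) sum_shift sum_zvec ?sE ?beN ?muN //.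
  exact: tails.
have box1 k z : G k z != 0 -> forall x, (fun=> 0) x <= z x <= (fun=> 0) x + (D k)%:Z.
  move=> /Gsum[z0 sz] x; rewrite z0 add0r /=.
  have : z x <= \sum_x z x by rewrite (bigD1 x) //= lerDl sumr_ge0.
  by rewrite sz /D; lia.
have box2 k z : G k z != 0 -> forall x, (k%:Z * zvec la x - Q%:Z) <= z x <=
     (k%:Z * zvec la x - Q%:Z) + (2 * Q)%N%:Z.
  move=> nz x; have [z0 sz] := Gsum _ _ nz.
  move: nz; rewrite /G tG; case: ifP => [tb nz|]; last by rewrite eqxx.
  have [|dom] := kostka_cost (fdec k) (fD k) tb _ nz.
    by rewrite -(tableZ_sum_row tb) sz fN.
  set lhs := (_ - height z); set rhs := (_ - _) => bound.
  have rhsE : rhs = kap.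
    rewrite /rhs /kap (eq_bigr (fun u => X u * shift (zvec be) w u + k%:Z * (X u * zvec mu u))).
      rewrite [X in _ + X - _](eq_bigr (fun v => Y v * shift (zvec ga) w' v +
         k%:Z * (Y v * zvec nu v))).
        rewrite [X in _ - X](eq_bigr (fun x => cost x * zvec al x + k%:Z * (cost x * zvec la x))).
          by rewrite !big_split /= -!mulr_sumr (tableZ_cost tL); ring.
        by move=> y _; rewrite /zvec /f PoszD PoszM; ring.
      by move=> v _; rewrite /shift /zvec nE PoszD PoszM; ring.
    by move=> u _; rewrite /shift /zvec nE PoszD PoszM; ring.
  have := psums_diff_le x dom; rewrite -/lhs /=.
  have := nth_le_sumn al x; rewrite rhsE in bound.
  by rewrite /zvec /f PoszD PoszM /Q; lia.
(* After recentring at k la, the index set and the margin condition are fixed, and each summand is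
   covered by [evconst_kostka]. *)
apply: (@evconst_eventually _ _ (fun k => \sum_(b : {ffun 'I_L -> 'I_(2 * Q).+1} |
    tableZ (fun x => (b x)%:Z - Q%:Z) (shift (zvec be) w) (shift (zvec ga) w'))
    kostka (D k) (f k) (fun x => ((b x)%:Z - Q%:Z) + k%:Z * (nth 0%N la x)%:Z)) 0).
  move=> k _; transitivity (\sum_(b : {ffun 'I_L -> 'I_(D k).+1}) G k (fun x => 0 + (b x)%:Z)).
    rewrite big_mkcond /=; apply: eq_bigr => A _; rewrite table_tableZ /G tG.
    rewrite (eq_tableZ (z' := fun x => (A x)%:Z) _ (fun=> erefl) (fun=> erefl)); last first.
      by move=> x; rewrite add0r.
    congr (if _ then _ else _); rewrite (@eq_kostka _ _ _ _ (fun x => (A x)%:Z)); last first.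
      by move=> x; rewrite add0r.
    by apply: eq_kostka_shape => i; exact: nE.
  rewrite (sum_box (Gext k) (box1 k) (box2 k)) [RHS]big_mkcond /=.
  apply: eq_bigr => b _; rewrite /G; set t1 := tableZ _ _ _; set t2 := tableZ _ _ _.
  have -> : t1 = t2 by apply: eq_tableZ => // x; ring.
  by case: ifP => // _; apply: eq_kostka => x; rewrite /zvec; ring.
apply: evconst_big => b _.
exact: (@evconst_kostka L (nth 0%N al) (nth 0%N la) D (fun x => (b x)%:Z - Q%:Z)
  (partition_dec alP) (partition_dec laP) fD).
Qed.

End AdditiveTables.

(** * The additive order on the cells of a grid *)

(* The 0-based index of the part of lambda that the star equations put in cell [(u, v)]. *)
Definition starpos (m n u v : nat) : nat :=
  if v == 0%N then u else (m + u * (n - 1) + (v - 1))%N.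

(* Extends the order of the star equations to a [p x q] grid: the [m x n] corner comes first,
   then the remaining rows of the first [n] columns, then the remaining columns. *)
Definition gridpos (m n p u v : nat) : nat :=
  if (n <= v)%N then (v * p + u)%N
  else if (m <= u)%N then (u * n + v)%N else starpos m n u v.

(* Weights for which [rowcost u + colcost v] is strictly increasing along [gridpos]: the
   factor [2 * m * n] exceeds every weight inside the [m x n] corner. *)
Definition rowcost (m n u : nat) : nat :=
  if (m <= u)%N then (2 * m * n * u)%N else (u * n)%N.
Definition colcost (m n p v : nat) : nat :=
  if (n <= v)%N then (2 * m * n * p * v)%N else if v == 0%N then 0%N else (m * n + v)%N.

Lemma lex_lt (a a' s b b' : nat) : (a < a')%N -> (b < s)%N -> (a * s + b < a' * s + b')%N.
Proof.
move=> aa bs; have : ((a.+1) * s <= a' * s)%N by rewrite leq_mul2r aa orbT.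
by lia.
Qed.

Lemma colcost_inc m n p v v' : (0 < m)%N -> (v < v' < n)%N ->
  (colcost m n p v < colcost m n p v')%N.
Proof.
move=> m0 h; rewrite /colcost; case: (leqP n v) => ?; first by lia.
case: (leqP n v') => ?; first by lia.
by case: eqP; case: eqP; lia.
Qed.

Lemma rowcost_inc m n u u' : (0 < m)%N -> (0 < n)%N -> (u < u')%N ->
  (rowcost m n u < rowcost m n u')%N.
Proof.
move=> m0 n0 uu; rewrite /rowcost; have mn0 : (0 < m * n)%N by rewrite muln_gt0 m0.
case: (leqP m u) => h1; case: (leqP m u') => h2; try lia.
- by rewrite ltn_mul2l uu andbT; lia.
- have : (u * n < m * n)%N by rewrite ltn_mul2r n0.
  have : (m * n * 1 <= m * n * u')%N by rewrite leq_mul2l; lia.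
  lia.
by rewrite ltn_mul2r n0.
Qed.

Section Grid.
Variables (m n p q : nat).
Hypotheses (m0 : (0 < m)%N) (n0 : (0 < n)%N) (mp : (m <= p)%N) (nq : (n <= q)%N).

Lemma starpos_lt u v : (u < m)%N -> (v < n)%N -> (starpos m n u v < m * n)%N.
Proof.
move=> um vn; have : (u.+1 * (n - 1) <= m * (n - 1))%N by rewrite leq_mul2r um orbT.
have : (m * n = m * (n - 1) + m)%N by rewrite -mulnSr; congr muln; lia.
by rewrite /starpos; case: eqP => v0; nia.
Qed.

(** The zones in increasing order of both position and cost are First, Block, Row, Col. Recording
    position and cost together lets one case analysis rewrite both. *)
Variant region_spec (u v : nat) : nat -> nat -> Type :=
| RegionCol of (n <= v)%N & (rowcost m n u < 2 * m * n * p)%N :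
    region_spec u v (v * p + u) (2 * m * n * p * v + rowcost m n u)
| RegionRow of (v < n)%N & (m <= u)%N & (colcost m n p v < 2 * m * n)%N :
    region_spec u v (u * n + v) (2 * m * n * u + colcost m n p v)
| RegionFirst of (v = 0%N) & (u < m)%N : region_spec u v u (u * n)
| RegionBlock of (0 < v < n)%N & (u < m)%N :
    region_spec u v (m + (u * (n - 1) + (v - 1))) (m * n + (u * n + v)).

Lemma colcost_lt v : (v < n)%N -> (colcost m n p v < 2 * m * n)%N.
Proof.
move=> vn; rewrite /colcost (leqNgt n v) vn /=; case: ifP => _.
  by rewrite muln_gt0 n0 muln_gt0 m0.
have : (1 * n <= m * n)%N by rewrite leq_mul2r m0 orbT.
lia.
Qed.

Lemma regionP u v : (u < p)%N ->
  region_spec u v (gridpos m n p u v) (rowcost m n u + colcost m n p v).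
Proof.
move=> up; rewrite /gridpos /colcost; case: leqP => [nv|vn].
  rewrite [(rowcost _ _ _ + _)%N]addnC; apply: RegionCol => //.
  have mn0 : (0 < m * n)%N by rewrite muln_gt0 m0.
  rewrite /rowcost; case: (leqP m u) => um.
    by rewrite ltn_mul2l up andbT; lia.
  have : (u * n < m * n)%N by rewrite ltn_mul2r n0.
  have : (m * n * 1 <= m * n * p)%N by rewrite leq_mul2l; lia.
  lia.
rewrite {1}/rowcost /starpos; case: (leqP m u) => um.
  rewrite [X in region_spec _ _ _ (_ + X)](_ : _ = colcost m n p v).
    by apply: RegionRow => //; exact: colcost_lt.
  by rewrite /colcost (leqNgt n v) vn.
case: eqP => v0; first by rewrite addn0; apply: RegionFirst.
rewrite -addnA (_ : u * n + (m * n + v) = m * n + (u * n + v))%N; last by lia.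
by apply: RegionBlock => //; lia.
Qed.

(** Different zones are separated by thresholds: m, m n and n p for positions, m n, 2 m n and 2 m n
    p for costs. Inside a zone both quantities follow the same lexicographic order. *)
Lemma gridpos_cost u v u' v' :
  (u < p)%N -> (u' < p)%N -> (u, v) <> (u', v') ->
  let c u v := (rowcost m n u + colcost m n p v)%N in
  ((gridpos m n p u v < gridpos m n p u' v') && (c u v < c u' v') ||
   (gridpos m n p u' v' < gridpos m n p u v) && (c u' v' < c u v))%N.
Proof.
move=> up up' ne /=.
have B1 w : (n <= w)%N -> (n * p <= w * p)%N /\ (2 * m * n * p <= 2 * m * n * p * w)%N.
  move=> nw; rewrite leq_mul2r nw orbT; split=> //.
  by rewrite -{1}[(_ * p)%N]muln1 leq_mul2l; lia.
have B2 w w' : (w < p)%N -> (w' < n)%N -> (w * n + w' < n * p)%N.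
  move=> wp w'n; rewrite [(n * p)%N]mulnC -[(p * n)%N]addn0; exact: lex_lt.
have B2c w w' : (w < p)%N -> (w' < 2 * m * n)%N -> (2 * m * n * w + w' < 2 * m * n * p)%N.
  move=> wp h; rewrite ![(2 * m * n * _)%N]mulnC -[(p * _)%N]addn0; exact: lex_lt.
have B3 w : (m <= w)%N -> (m * n <= w * n)%N /\ (2 * m * n <= 2 * m * n * w)%N.
  move=> mw; rewrite leq_mul2r mw orbT; split=> //.
  by rewrite -{1}[(2 * m * n)%N]muln1 leq_mul2l; lia.
have B4 w w' : (w < m)%N -> (0 < w' < n)%N ->
   (m + (w * (n - 1) + (w' - 1)) < m * n)%N /\ (w * n + w' < m * n)%N.
  move=> wm wn; split; last first.
    by rewrite -[(m * n)%N]addn0; apply: lex_lt => //; lia.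
  have /andP[w0 wn'] := wn.
  have := starpos_lt wm wn'; rewrite /starpos; case: eqP; lia.
have B5 w : (w < m)%N -> (w * n < m * n)%N by move=> wm; rewrite ltn_mul2r n0.
have mn : (m <= m * n)%N by rewrite leq_pmulr.
have mnp : (m * n <= n * p)%N by rewrite mulnC leq_mul2l mp orbT.
have mnp2 : (2 * m * n <= 2 * m * n * p)%N by rewrite leq_pmulr //; lia.
case: (regionP v up) => [nv c1|vn um c1|v0 um|vn um];
case: (regionP v' up') => [nv' c1'|vn' um' c1'|v0' um'|vn' um'].
- have [lt|lt|e] := ltngtP v v'.
  + by apply/orP; left; rewrite lex_lt //= ![(2 * m * n * p * _)%N]mulnC lex_lt.
  + by apply/orP; right; rewrite lex_lt //= ![(2 * m * n * p * _)%N]mulnC lex_lt.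
  have [lt|lt|e'] := ltngtP u u'; last by case: ne; rewrite e e'.
  + by have := rowcost_inc m0 n0 lt; rewrite e; lia.
  by have := rowcost_inc m0 n0 lt; rewrite e; lia.
- by have [] := B1 _ nv; have := B2 _ _ up' vn'; have := B2c _ _ up' c1'; lia.
- by have [] := B1 _ nv; have := B5 _ um'; lia.
- by have [] := B1 _ nv; have [] := B4 _ _ um' vn'; lia.
- by have [] := B1 _ nv'; have := B2 _ _ up vn; have := B2c _ _ up c1; lia.
- have [lt|lt|e] := ltngtP u u'.
  + by apply/orP; left; rewrite lex_lt //= ![(2 * m * n * _)%N]mulnC lex_lt.
  + by apply/orP; right; rewrite lex_lt //= ![(2 * m * n * _)%N]mulnC lex_lt.
  have [lt|lt|e'] := ltngtP v v'; last by case: ne; rewrite e e'.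
  + by have := @colcost_inc m n p v v' m0; rewrite lt vn' => /(_ isT); rewrite e; lia.
  by have := @colcost_inc m n p v' v m0; rewrite lt vn => /(_ isT); rewrite e; lia.
- by have [] := B3 _ um; have := B5 _ um'; lia.
- by have [] := B3 _ um; have [] := B4 _ _ um' vn'; lia.
- by have [] := B1 _ nv'; have := B5 _ um; lia.
- by have [] := B3 _ um'; have := B5 _ um; lia.
- have [lt|lt|e'] := ltngtP u u'; last by case: ne; rewrite v0 v0' e'.
  + by rewrite !ltn_mul2r n0; lia.
  by rewrite !ltn_mul2r n0; lia.
- by rewrite !ltn_addr // B5.
- by have [] := B1 _ nv'; have [] := B4 _ _ um vn; lia.
- by have [] := B3 _ um'; have [] := B4 _ _ um vn; lia.
- by apply/orP; right; rewrite !ltn_addr // B5.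
rewrite !ltn_add2l; have [lt|lt|e] := ltngtP u u'.
+ by apply/orP; left; rewrite !lex_lt //; lia.
+ by apply/orP; right; rewrite !lex_lt //; lia.
have [lt|lt|e'] := ltngtP v v'; last by case: ne; rewrite e e'.
+ by rewrite e; lia.
by rewrite e; lia.
Qed.

End Grid.

(** * The star equations as margins of a table *)

Definition star_table (T : nmodType) (m n : nat) (l a b : nat -> T) : Prop :=
  (forall u, (u < m)%N -> a u = \sum_(v < n) l (starpos m n u v)) /\
  (forall v, (v < n)%N -> b v = \sum_(u < m) l (starpos m n u v)).

(** The first column holds the first m parts, and row u continues with the u-th block of n - 1
    consecutive parts: this is [starpos] with indices counted from 0. *)
Lemma star_eqsP (T : nmodType) (m n : nat) (L M V : nat -> T) : (0 < n)%N ->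
  star_eqs m n L M V <->
  star_table m n (fun i => L i.+1) (fun i => M i.+1) (fun i => V i.+1).
Proof.
case: n => // n _; rewrite /star_eqs /star_table.
have row u : L u.+1 + \sum_((m + (u.+1 - 1) * (n.+1 - 1)).+1 <= i < (m + u.+1 * (n.+1 - 1)).+1) L i
    = \sum_(v < n.+1) L (starpos m n.+1 u v).+1.
  rewrite big_ord_recl /=; congr (_ + _).
  rewrite !subSS !subn0 -[X in \sum_(X <= _ < _) _]add0n big_addn big_mkord.
  have -> : ((m + u.+1 * n).+1 - (m + u * n).+1 = n)%N by rewrite mulSn; lia.
  by apply: eq_bigr => v _; congr L; rewrite /starpos /= /bump /= subSS subn0; lia.
have col1 : \sum_(1 <= i < m.+1) L i = \sum_(u < m) L (starpos m n.+1 u 0).+1.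
  by rewrite big_add1 big_mkord.
have col v : (0 < v)%N -> \sum_(0 <= i < m) L (m + (n.+1 - 1) * i + v.+1 - 1)%N =
    \sum_(u < m) L (starpos m n.+1 u v).+1.
  move=> v0; rewrite big_mkord; apply: eq_bigr => u _; congr L.
  by rewrite /starpos (gtn_eqF v0) mulnC; lia.
split=> [[h1 h2 h3]|[h1 h2]]; split.
- by move=> u um; rewrite h1 // row.
- case=> [|v] vn; first by rewrite h2 col1.
  by rewrite h3 // col.
- by case=> // u /= um; rewrite h1 // -row.
- by rewrite h2 // col1.
by case=> // v /= vn; rewrite h2 ?col //; lia.
Qed.

Lemma partition_tail0 (s : seq nat) k : is_partition s -> (ell s <= k)%N -> tail0 k s.
Proof.
rewrite /tail0 /ell; elim: s k => [|x s IH] k sP le i ki; first by rewrite nth_nil.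
have sP' : is_partition s := path_sorted sP.
case: x sP le => [|x] sP /= le; last by case: k i ki le => [|k] [|i] //= ki le; apply: (IH k).
by have := partition_nth_le sP (leq0n i); rewrite /=; lia.
Qed.

Section GridTables.
Variables (m n p q : nat).
Hypotheses (m0 : (0 < m)%N) (n0 : (0 < n)%N) (mp : (m <= p)%N) (nq : (n <= q)%N).

Lemma gridpos_outside u v : (m <= u)%N || (n <= v)%N -> (m * n <= gridpos m n p u v)%N.
Proof.
rewrite /gridpos => h; case: (leqP n v) => [nv|vn].
  by apply: leq_trans (leq_addr _ _); rewrite mulnC leq_mul.
have um : (m <= u)%N by move: h; rewrite leqNgt (leqNgt n) vn orbF.
by rewrite um; apply: leq_trans (leq_addr _ _); rewrite leq_mul2r um orbT.
Qed.

Lemma gridpos_inside u v : (u < m)%N -> (v < n)%N -> gridpos m n p u v = starpos m n u v.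
Proof. by move=> um vn; rewrite /gridpos (leqNgt n v) (leqNgt m u) um vn. Qed.

Lemma gridpos_lt u v : (u < p)%N -> (v < q)%N -> (gridpos m n p u v < p * q)%N.
Proof.
move=> up vq; rewrite /gridpos; case: (leqP n v) => [nv|vn].
  by rewrite [(p * q)%N]mulnC -[(q * p)%N]addn0 lex_lt.
have le : (m * n <= p * q)%N by rewrite leq_mul.
case: (leqP m u) => [um|um]; last by apply: leq_trans le; apply: starpos_lt.
apply: leq_trans (_ : p * n <= _)%N; last by rewrite leq_mul2l nq orbT.
by rewrite -[(p * n)%N]addn0 lex_lt.
Qed.

(** Distinct cells have distinct positions by [gridpos_cost], so numbering by position is a
    bijection by cardinality, and the same lemma makes the cost increase along it. *)
Lemma grid_exists : exists (row : 'I_(p * q) -> 'I_p) (col : 'I_(p * q) -> 'I_q)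
    (cell : 'I_p -> 'I_q -> 'I_(p * q)),
  [/\ (forall u v, row (cell u v) = u), (forall u v, col (cell u v) = v),
      (forall x, cell (row x) (col x) = x),
      (forall u v, cell u v = gridpos m n p u v :> nat) &
      (forall x y : 'I_(p * q), (x < y)%N ->
         cost row col (fun u => (rowcost m n u)%:Z) (fun v => (colcost m n p v)%:Z) x <
         cost row col (fun u => (rowcost m n u)%:Z) (fun v => (colcost m n p v)%:Z) y)].
Proof.
pose f (uv : 'I_p * 'I_q) : 'I_(p * q) := Ordinal (gridpos_lt (ltn_ord uv.1) (ltn_ord uv.2)).
have key (a b : 'I_p * 'I_q) : a <> b ->
    ((f a < f b) && (rowcost m n a.1 + colcost m n p a.2 < rowcost m n b.1 + colcost m n p b.2) ||
     (f b < f a) && (rowcost m n b.1 + colcost m n p b.2 < rowcost m n a.1 + colcost m n p a.2))%N.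
  case: a b => [u v] [u' v'] ne; apply: gridpos_cost => //=.
  by case=> /val_inj e /val_inj e'; apply: ne; rewrite e e'.
have fI : injective f.
  move=> a b e; apply/eqP; apply: contra_eqT e => /eqP /key; rewrite -val_eqE /=; lia.
have [g fK gK] : bijective f by apply: inj_card_bij => //; rewrite card_prod !card_ord.
exists (fun x => (g x).1), (fun x => (g x).2), (fun u v => f (u, v)); split.
- by move=> u v; rewrite fK.
- by move=> u v; rewrite fK.
- by move=> x; rewrite -surjective_pairing gK.
- by [].
move=> x y xy; rewrite /cost -!PoszD ltz_nat.
have := @key (g x) (g y); rewrite !gK (ltnNge y) (ltnW xy) /= orbF xy /=; apply.
by move=> e; move: xy; rewrite -(gK x) e gK ltnn.
Qed.

Lemma sum_fiber_row (T : nmodType) (row : 'I_(p * q) -> 'I_p) (col : 'I_(p * q) -> 'I_q)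
    (cell : 'I_p -> 'I_q -> 'I_(p * q)) (F : 'I_(p * q) -> T) u :
  (forall u v, row (cell u v) = u) -> (forall u v, col (cell u v) = v) ->
  (forall x, cell (row x) (col x) = x) ->
  \sum_(x | row x == u) F x = \sum_v F (cell u v).
Proof.
move=> rc cc crc; rewrite (reindex_onto (cell u) col) => [|x /eqP <-]; last exact: crc.
by apply: eq_bigl => v; rewrite rc cc !eqxx.
Qed.

Lemma sum_fiber_col (T : nmodType) (row : 'I_(p * q) -> 'I_p) (col : 'I_(p * q) -> 'I_q)
    (cell : 'I_p -> 'I_q -> 'I_(p * q)) (F : 'I_(p * q) -> T) v :
  (forall u v, row (cell u v) = u) -> (forall u v, col (cell u v) = v) ->
  (forall x, cell (row x) (col x) = x) ->
  \sum_(x | col x == v) F x = \sum_u F (cell u v).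
Proof.
move=> rc cc crc; rewrite (reindex_onto (cell^~ v) row) => [|x /eqP <-]; last exact: crc.
by apply: eq_bigl => u; rewrite rc cc !eqxx.
Qed.

(** Cells outside the m x n corner sit at positions at least m n, where [la] is 0, so enlarging the
    grid only adds zero rows and columns. *)
Lemma star_table_tableZ (row : 'I_(p * q) -> 'I_p) (col : 'I_(p * q) -> 'I_q)
    (cell : 'I_p -> 'I_q -> 'I_(p * q)) (la mu nu : seq nat) :
  (forall u v, row (cell u v) = u) -> (forall u v, col (cell u v) = v) ->
  (forall x, cell (row x) (col x) = x) ->
  (forall u v, cell u v = gridpos m n p u v :> nat) ->
  tail0 (m * n) la -> tail0 m mu -> tail0 n nu ->
  star_table m n (nth 0%N la) (nth 0%N mu) (nth 0%N nu) <->
  tableZ row col (zvec la) (zvec mu) (zvec nu).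
Proof.
move=> rc cc crc cE la0 mu0 nu0.
have rowE (u : 'I_p) : \sum_(x | row x == u) zvec la x =
    (if (u < m)%N then \sum_(v < n) nth 0%N la (starpos m n u v) else 0)%N%:Z.
  rewrite (sum_fiber_row _ _ rc cc crc) /zvec -natz_sum; congr (_%:Z).
  under eq_bigr do rewrite cE.
  case: ltnP => um; last by rewrite big1 // => v _; rewrite la0 // gridpos_outside ?um.
  rewrite (@sum_ord_widen _ (fun v => nth 0%N la (gridpos m n p u v)) n q) //.
    by apply: eq_bigr => v _; rewrite gridpos_inside.
  by move=> v nv; rewrite la0 // gridpos_outside ?nv ?orbT.
have colE (v : 'I_q) : \sum_(x | col x == v) zvec la x =
    (if (v < n)%N then \sum_(u < m) nth 0%N la (starpos m n u v) else 0)%N%:Z.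
  rewrite (sum_fiber_col _ _ rc cc crc) /zvec -natz_sum; congr (_%:Z).
  under eq_bigr do rewrite cE.
  case: ltnP => vn; last by rewrite big1 // => u _; rewrite la0 // gridpos_outside ?vn ?orbT.
  rewrite (@sum_ord_widen _ (fun u => nth 0%N la (gridpos m n p u v)) m p) //.
    by apply: eq_bigr => u _; rewrite gridpos_inside.
  by move=> u nu'; rewrite la0 // gridpos_outside ?nu'.
split=> [[h1 h2]|/tableZP[h1 h2]].
  apply/tableZP; split=> u; rewrite (rowE, colE) /zvec; case: ltnP => hu.
  - by rewrite h1.
  - by rewrite mu0.
  - by rewrite h2.
  by rewrite nu0.
split=> u hu.
  have := h1 (Ordinal (leq_trans hu mp)); rewrite rowE /= hu => -[e].
  by rewrite e.
have := h2 (Ordinal (leq_trans hu nq)); rewrite colE /= hu => -[e].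
by rewrite e.
Qed.

End GridTables.

Section StarTriples.
Variables (m n : nat) (m0 : (0 < m)%N) (n0 : (0 < n)%N).
Variables (la mu nu : seq nat).
Hypotheses (laP : is_partition la) (muP : is_partition mu) (nuP : is_partition nu).
Hypotheses (la0 : tail0 (m * n) la) (mu0 : tail0 m mu) (nu0 : tail0 n nu).
Hypothesis star : star_table m n (nth 0%N la) (nth 0%N mu) (nth 0%N nu).

Lemma star_stable : stable_triple la mu nu.
Proof.
move=> al be ga alP beP gaP.
(* The arbitrary partitions [al], [be], [ga] may be longer than m n, m, n; the grid is enlarged
   until they fit. *)
pose d := (size al + size be + size ga)%N; pose p := (m + d)%N; pose q := (n + d)%N.
have mp : (m <= p)%N by apply: leq_addr.
have nq : (n <= q)%N by apply: leq_addr.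
have [row [col [cell [rc cc crc cE cinc]]]] := grid_exists m0 n0 mp nq.
have tL := (star_table_tableZ mp nq rc cc crc cE la0 mu0 nu0).1 star.
have tail_le k k' s : (k <= k')%N -> tail0 k s -> tail0 k' s.
  by move=> kk s0 i ki; rewrite s0 // (leq_trans kk).
have tail_size s : tail0 (size s) s by move=> i; exact: nth_default.
have sal : (size al <= p * q)%N by apply: leq_trans (leq_pmulr _ _); rewrite /p /q /d; lia.
have sbe : (size be <= p)%N by rewrite /p /d; lia.
have sga : (size ga <= q)%N by rewrite /q /d; lia.
have [c [K h]] := kron_stable rc cc crc cinc laP muP nuP alP beP gaP
  (tail_le _ _ _ (leq_mul mp nq) la0) (tail_le _ _ _ mp mu0) (tail_le _ _ _ nq nu0)
  (tail_le _ _ _ sal (tail_size al)) (tail_le _ _ _ sbe (tail_size be))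
  (tail_le _ _ _ sga (tail_size ga)) tL.
by exists K => k Kk; rewrite !h.
Qed.

Lemma star_kron1 : kron la mu nu = 1.
Proof.
have [row [col [cell [rc cc crc cE cinc]]]] := grid_exists m0 n0 (leqnn m) (leqnn n).
have tL := (star_table_tableZ (leqnn m) (leqnn n) rc cc crc cE la0 mu0 nu0).1 star.
apply: (kron_table rc cc crc cinc _ _ la0 mu0 nu0 laP muP nuP tL) => u u' uu.
  by rewrite ltz_nat rowcost_inc.
by rewrite ltz_nat colcost_inc // uu ltn_ord.
Qed.

End StarTriples.

(** * The face *)

Lemma star_table_pscale m n k la mu nu :
  star_table m n (nth 0%N la) (nth 0%N mu) (nth 0%N nu) ->
  star_table m n (nth 0%N (pscale k la)) (nth 0%N (pscale k mu)) (nth 0%N (pscale k nu)).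
Proof.
move=> [h1 h2]; split=> u hu; rewrite nth_pscale ?h1 ?h2 // big_distrr /=;
  by apply: eq_bigr => v _; rewrite nth_pscale.
Qed.

Lemma tail0_pscale N k s : tail0 N s -> tail0 N (pscale k s).
Proof. by move=> s0 i Ni; rewrite nth_pscale s0 // muln0. Qed.

Lemma star_weakly_stable m n la mu nu : (0 < m)%N -> (0 < n)%N ->
  is_partition la -> is_partition mu -> is_partition nu ->
  tail0 (m * n) la -> tail0 m mu -> tail0 n nu ->
  star_table m n (nth 0%N la) (nth 0%N mu) (nth 0%N nu) -> weakly_stable la mu nu.
Proof.
move=> m0 n0 laP muP nuP la0 mu0 nu0 st k _.
apply: (@star_kron1 m n) => //; try exact: is_partition_pscale; try exact: tail0_pscale.
exact: star_table_pscale.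
Qed.

Definition ordseq (k : nat) (F : 'I_k -> nat) : seq nat := [seq F i | i <- enum 'I_k].

Lemma nth_ordseq k (F : 'I_k -> nat) (i : 'I_k) : nth 0%N (ordseq F) i = F i.
Proof. by rewrite (nth_map i) ?size_enum_ord // nth_ord_enum. Qed.

Lemma size_ordseq k (F : 'I_k -> nat) : size (ordseq F) = k.
Proof. by rewrite size_map size_enum_ord. Qed.

Lemma tail0_ordseq k (F : 'I_k -> nat) : tail0 k (ordseq F).
Proof. by move=> i ki; rewrite nth_default // size_ordseq. Qed.

Lemma ell_ordseq k (F : 'I_k -> nat) : (ell (ordseq F) <= k)%N.
Proof. by rewrite -[leqRHS](size_ordseq F); exact: count_size. Qed.

Lemma is_partition_ordseq k (F : 'I_k -> nat) :
  (forall i j : 'I_k, (i <= j)%N -> (F j <= F i)%N) -> is_partition (ordseq F).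
Proof.
move=> dec; apply/is_partitionP=> i; have [lt|ge] := ltnP i.+1 k; last first.
  by rewrite tail0_ordseq.
have := nth_ordseq F (Ordinal lt); have := nth_ordseq F (Ordinal (ltnW lt)) => /= -> ->.
exact: dec.
Qed.

Lemma starpos_inc m n u u' v : (u <= u')%N -> (starpos m n u v <= starpos m n u' v)%N.
Proof.
rewrite /starpos => uu; case: eqP => // _.
by rewrite leq_add2r leq_add2l leq_mul2r uu orbT.
Qed.

Lemma starpos_incr m n u v v' : (u < m)%N -> (v <= v')%N ->
  (starpos m n u v <= starpos m n u v')%N.
Proof.
rewrite /starpos => um vv; case: (v =P 0%N) => v0; case: (v' =P 0%N) => v0' //; try lia.
by rewrite -addnA; apply: leq_trans (leq_addr _ _); exact: ltnW.
Qed.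

Definition rowsums m n (la : seq nat) : seq nat :=
  ordseq (fun u : 'I_m => \sum_(v < n) nth 0%N la (starpos m n u v))%N.
Definition colsums m n (la : seq nat) : seq nat :=
  ordseq (fun v : 'I_n => \sum_(u < m) nth 0%N la (starpos m n u v))%N.

Lemma star_table_sums m n la :
  star_table m n (nth 0%N la) (nth 0%N (rowsums m n la)) (nth 0%N (colsums m n la)).
Proof.
by split=> u hu; [have := nth_ordseq _ (Ordinal hu : 'I_m)|
  have := nth_ordseq _ (Ordinal hu : 'I_n)]; apply.
Qed.

Lemma is_partition_rowsums m n la : is_partition la -> is_partition (rowsums m n la).
Proof.
move=> laP; apply: is_partition_ordseq => i j ij; apply: leq_sum => v _.
by apply: partition_nth_le => //; apply: starpos_inc.
Qed.

Lemma is_partition_colsums m n la : is_partition la -> is_partition (colsums m n la).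
Proof.
move=> laP; apply: is_partition_ordseq => i j ij; apply: leq_sum => v _.
by apply: partition_nth_le => //; apply: starpos_incr.
Qed.

Lemma sum_Idx (T : nmodType) l m n (F : Idx l m n -> T) :
  \sum_t F t = \sum_i F (inl (inl i)) + \sum_j F (inl (inr j)) + \sum_k F (inr k).
Proof. by rewrite !big_sumType. Qed.

(** The column partition with k + 1 parts. Together with their margins, these partitions for k < m n
    generate the cone [tau]. *)
Definition ones (k : nat) : seq nat := nseq k.+1 1%N.

Lemma nth_ones k i : nth 0%N (ones k) i = (i <= k)%N.
Proof. by rewrite nth_nseq ltnS; case: leqP. Qed.

Lemma is_partition_ones k : is_partition (ones k).
Proof. by apply/is_partitionP=> i; rewrite !nth_ones; lia. Qed.

Lemma tail0_ones k N : (k < N)%N -> tail0 N (ones k).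
Proof. by move=> kN i Ni; rewrite nth_ones; lia. Qed.

Section Face.
Variables (R : realType) (m n : nat) (m0 : (0 < m)%N) (n0 : (0 < n)%N).
Local Notation pt := {ffun Idx (m * n) m n -> R}.

Lemma coord1_ord k (f : 'I_k -> R) (i : 'I_k) : coord1 f i.+1 = f i.
Proof. by rewrite /coord1 /= valK. Qed.

Lemma coord1_ge k (f : 'I_k -> R) i : (k <= i)%N -> coord1 f i.+1 = 0.
Proof. by move=> ki; rewrite /coord1 /= insubF // ltnNge ki. Qed.

Definition lpart (x : pt) (i : nat) : R := coord1 (fun i => x (inl (inl i))) i.+1.

Lemma tauP (x : pt) : tau x <->
  [/\ star_table m n (lpart x) (coord1 (fun j => x (inl (inr j))) \o S)
        (coord1 (fun k => x (inr k)) \o S) &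
      (forall i, 0 <= lpart x i) /\ (forall i j, (i <= j)%N -> lpart x j <= lpart x i)].
Proof.
have starR (u : 'I_m) (v : 'I_n) : (starpos m n u v < m * n)%N by apply: starpos_lt.
have lge (i : 'I_(m * n)) : lpart x i = x (inl (inl i)) by rewrite /lpart coord1_ord.
split=> [[/star_eqsP-/(_ n0) st [x0 xdec] _ _]|[st [x0 xdec]]]; split.
- exact: st.
- have nn i : 0 <= lpart x i.
    have [lt|ge] := ltnP i (m * n)%N; last by rewrite /lpart coord1_ge.
    by rewrite (lge (Ordinal lt)).
  split=> // i j ij; have [lt|ge] := ltnP j (m * n)%N; last by rewrite /lpart coord1_ge ?nn.
  by rewrite (lge (Ordinal lt)) (lge (Ordinal (leq_ltn_trans ij lt))) xdec.
- by apply/star_eqsP.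
- by split=> [i|i j ij]; rewrite -!lge // xdec.
- case: st => rE _; have xE (u : 'I_m) : x (inl (inr u)) = \sum_(v < n) lpart x (starpos m n u v).
    by rewrite -rE //= coord1_ord.
  split=> [u|u u' uu]; rewrite !xE; first by apply: sumr_ge0.
  by apply: ler_sum => v _; apply: xdec; apply: starpos_inc.
case: st => _ cE; have xE (v : 'I_n) : x (inr v) = \sum_(u < m) lpart x (starpos m n u v).
  by rewrite -cE //= coord1_ord.
split=> [u|u u' uu]; rewrite !xE; first by apply: sumr_ge0.
by apply: ler_sum => v _; apply: xdec; apply: starpos_incr.
Qed.

Lemma lpart_embed la mu nu i : tail0 (m * n) la ->
  lpart (embed R (m * n) m n la mu nu) i = (nth 0%N la i)%:R.
Proof.
move=> la0; have [lt|ge] := ltnP i (m * n)%N; last by rewrite /lpart coord1_ge // la0.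
by rewrite /lpart (coord1_ord _ (Ordinal lt)) ffunE.
Qed.

Lemma tau_embed la mu nu : is_partition la -> tail0 (m * n) la ->
  star_table m n (nth 0%N la) (nth 0%N mu) (nth 0%N nu) <->
  tau (embed R (m * n) m n la mu nu).
Proof.
move=> laP la0; have lE i := lpart_embed mu nu i la0.
have rE u (hu : (u < m)%N) : (coord1 (fun j => embed R (m * n) m n la mu nu (inl (inr j))) \o S) u
   = (nth 0%N mu u)%:R by rewrite /= (coord1_ord _ (Ordinal hu)) ffunE.
have cE v (hv : (v < n)%N) : (coord1 (fun k => embed R (m * n) m n la mu nu (inr k)) \o S) v
   = (nth 0%N nu v)%:R by rewrite /= (coord1_ord _ (Ordinal hv)) ffunE.
split=> [[h1 h2]|/tauP[[h1 h2] _]].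
  apply/tauP; split; last first.
    split=> [i|i j ij]; rewrite !lE ?ler0n // ler_nat; exact: partition_nth_le.
  split=> u hu; [rewrite rE // h1 // natr_sum|rewrite cE // h2 // natr_sum];
    by apply: eq_bigr => v _; rewrite lE.
split=> u hu; apply/eqP; rewrite -(eqr_nat R).
  by rewrite -rE // h1 // natr_sum; apply/eqP; apply: eq_bigr => v _; rewrite lE.
by rewrite -cE // h2 // natr_sum; apply/eqP; apply: eq_bigr => v _; rewrite lE.
Qed.

(** The disjunction is what a vanishing sum of nonnegative terms provides: a generator either has
    coefficient 0 or lies in [tau]. *)
Lemma tau_comb (I : Type) (s : seq I) (c : I -> R) (g : I -> pt) :
  (forall j, 0 <= c j) -> (forall j, c j = 0 \/ tau (g j)) ->
  tau [ffun t => \sum_(j <- s) c j * g j t].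
Proof.
move=> c0 cg.
have coordE k (h : I -> 'I_k -> R) i :
    coord1 (fun x => \sum_(j <- s) c j * h j x) i = \sum_(j <- s) c j * coord1 (h j) i.
  rewrite /coord1; case: (insub _) => [x|]; last by rewrite big1 // => j _; rewrite mulr0.
  by case: ifP => // _; rewrite big1 // => j _; rewrite mulr0.
have ext k (f h : 'I_k -> R) i : f =1 h -> coord1 f i = coord1 h i.
  by move=> fh; rewrite /coord1; case: (insub _) => // x; rewrite fh.
have lE i : lpart [ffun t => \sum_(j <- s) c j * g j t] i = \sum_(j <- s) c j * lpart (g j) i.
  by rewrite /lpart -coordE; apply: ext => x; rewrite ffunE.
apply/tauP; split; last first.
  split=> [i|i j ij]; rewrite !lE; [apply: sumr_ge0 => k _|apply: ler_sum => k _];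
    case: (cg k) => [->|/tauP[_ [x0 xdec]]]; rewrite ?mul0r // ?mulr_ge0 //.
  by rewrite ler_wpM2l // xdec.
split=> u hu.
  transitivity (\sum_(j <- s) c j * coord1 (fun i => g j (inl (inr i))) u.+1).
    by rewrite -coordE; apply: ext => x; rewrite ffunE.
  under [RHS]eq_bigr do rewrite lE.
  rewrite exchange_big /=; apply: eq_bigr => j _; rewrite -mulr_sumr.
  by case: (cg j) => [->|/tauP[[h1 _] _]]; rewrite ?mul0r // -h1.
transitivity (\sum_(j <- s) c j * coord1 (fun i => g j (inr i)) u.+1).
  by rewrite -coordE; apply: ext => x; rewrite ffunE.
under [RHS]eq_bigr do rewrite lE.
rewrite exchange_big /=; apply: eq_bigr => j _; rewrite -mulr_sumr.
by case: (cg j) => [->|/tauP[[_ h2] _]]; rewrite ?mul0r // -h2.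
Qed.

Lemma telescope_indicator (f : nat -> R) N i : (i <= N)%N ->
  \sum_(k < N) (f k - f k.+1) * (i <= k)%:R = f i - f N.
Proof.
elim: N => [|N IH]; first by rewrite leqn0 => /eqP ->; rewrite big_ord0 subrr.
rewrite leq_eqVlt => /orP[/eqP ->|iN].
  by rewrite subrr big1 // => k _; rewrite leqNgt ltn_ord mulr0.
by rewrite big_ord_recr /= IH // -ltnS iN mulr1; ring.
Qed.

Definition extremal (k : nat) : pt :=
  embed R (m * n) m n (ones k) (rowsums m n (ones k)) (colsums m n (ones k)).

(** A decreasing sequence ending in 0 is the combination of the indicators [ones k] with its
    successive differences as coefficients; the margins follow by linearity. *)
Lemma tau_decomp (x : pt) : tau x ->
  x = [ffun t => \sum_(k < m * n) (lpart x k - lpart x k.+1) * extremal k t].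
Proof.
move=> /tauP[[h1 h2] _].
have lN : lpart x (m * n) = 0 by rewrite /lpart coord1_ge.
have tele i : (i < m * n)%N ->
    \sum_(k < m * n) (lpart x k - lpart x k.+1) * (nth 0%N (ones k) i)%:R = lpart x i.
  move=> hi; under eq_bigr do rewrite nth_ones.
  by rewrite telescope_indicator ?lN ?subr0 // ltnW.
apply/ffunP=> -[[i|u]|v]; rewrite ffunE.
- by under eq_bigr do rewrite ffunE; rewrite tele // /lpart coord1_ord.
- rewrite -[LHS](coord1_ord (fun j => x (inl (inr j)))) -/((coord1 _ \o S) u) h1 //.
  under [RHS]eq_bigr do rewrite ffunE nth_ordseq natr_sum mulr_sumr.
  rewrite exchange_big /=; apply: eq_bigr => v _; rewrite tele //; exact: starpos_lt.
rewrite -[LHS](coord1_ord (fun j => x (inr j))) -/((coord1 _ \o S) v) h2 //.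
under [RHS]eq_bigr do rewrite ffunE nth_ordseq natr_sum mulr_sumr.
rewrite exchange_big /=; apply: eq_bigr => u _; rewrite tele //; exact: starpos_lt.
Qed.

End Face.

Section StableFace.
Variables (R : realType) (m n : nat) (m0 : (0 < m)%N) (n0 : (0 < n)%N).
Local Notation pt := {ffun Idx (m * n) m n -> R}.

(** The sign makes the functional the margin cost minus the cost of [la], which [kron_cost] shows to
    be nonnegative on the semigroup. *)
Definition functional (c : 'I_(m * n) -> int) (X : 'I_m -> int) (Y : 'I_n -> int) : pt :=
  [ffun t : Idx (m * n) m n => match t return R with
     | inl (inl i) => - (c i)%:~R
     | inl (inr u) => (X u)%:~R
     | inr v => (Y v)%:~R end].

Lemma functional_embed c X Y la mu nu :
  \sum_t functional c X Y t * embed R (m * n) m n la mu nu t =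
  (\sum_u X u * zvec mu u + \sum_v Y v * zvec nu v - \sum_x c x * zvec la x)%:~R.
Proof.
rewrite sum_Idx rmorphB rmorphD !rmorph_sum /= -sumrN [RHS]addrC [RHS]addrA.
by congr (_ + _ + _); apply: eq_bigr => i _; rewrite !ffunE rmorphM //= mulNr.
Qed.

Lemma functional_comb (w : pt) r (c : 'I_r -> R) (g : 'I_r -> pt) :
  \sum_t w t * [ffun t => \sum_(j < r) c j * g j t] t = \sum_(j < r) c j * \sum_t w t * g j t.
Proof.
under eq_bigr do rewrite ffunE mulr_sumr.
rewrite exchange_big /=; apply: eq_bigr => j _; rewrite mulr_sumr.
by apply: eq_bigr => t _; rewrite mulrCA.
Qed.

Lemma kron_semigroup_extremal k : (k < m * n)%N -> kron_semigroup (@extremal R m n k).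
Proof.
move=> kN; have onesP := is_partition_ones k.
exists (ones k), (rowsums m n (ones k)), (colsums m n (ones k)); split=> //.
- rewrite /ell count_nseq /=; lia.
- exact: ell_ordseq.
- exact: ell_ordseq.
rewrite (@star_kron1 m n) //; first exact: is_partition_rowsums.
- exact: is_partition_colsums.
- exact: tail0_ones.
- exact: tail0_ordseq.
- exact: tail0_ordseq.
exact: star_table_sums.
Qed.

Lemma tau_face : is_face (@PKron R (m * n) m n) (@tau R m n).
Proof.
have [row [col [cell [rc cc crc cE cinc]]]] := grid_exists m0 n0 (leqnn m) (leqnn n).
pose X (u : 'I_m) := (rowcost m n u)%:Z; pose Y (v : 'I_n) := (colcost m n m v)%:Z.
have Xinc (u u' : 'I_m) : (u < u')%N -> X u < X u'.
  by move=> uu; rewrite ltz_nat rowcost_inc.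
have Yinc (v v' : 'I_n) : (v < v')%N -> Y v < Y v'.
  by move=> vv; rewrite ltz_nat colcost_inc // vv ltn_ord.
pose w := functional (cost row col X Y) X Y.
(* On generators the functional is nonnegative and vanishes exactly on [tau]; both properties then
   extend to nonnegative combinations. *)
have gen g : kron_semigroup g -> 0 <= \sum_t w t * g t /\ (\sum_t w t * g t = 0 <-> tau g).
  move=> [la [mu [nu [ella ellmu ellnu nz ->]]]].
  have [laP muP nuP _ _] := kron_neq0 nz.
  have la0 := partition_tail0 laP ella; have mu0 := partition_tail0 muP ellmu.
  have nu0 := partition_tail0 nuP ellnu.
  have [le eqE] := kron_cost rc cc crc cinc Xinc Yinc la0 mu0 nu0 nz.
  rewrite functional_embed; split; first by rewrite ler0z subr_ge0.
  have tabP := star_table_tableZ (leqnn m) (leqnn n) rc cc crc cE la0 mu0 nu0.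
  have embP := @tau_embed R m n m0 n0 la mu nu laP la0.
  split=> [/eqP|/embP/tabP t].
    by rewrite intr_eq0 subr_eq0 eq_sym eqE => /tabP/embP.
  by apply/eqP; rewrite intr_eq0 subr_eq0 eq_sym eqE.
exists w; split=> [_ [r [c [g [cg ->]]]]|x].
  rewrite functional_comb; apply: sumr_ge0 => j _; have [cj /gen[gj _]] := cg j.
  exact: mulr_ge0.
split=> [tx|[[r [c [g [cg ->]]]]]].
  have /(tauP m0 n0)[_ [x0 xdec]] := tx.
  rewrite (tau_decomp m0 n0 tx); split.
    exists (m * n)%N, (fun k => lpart x k - lpart x k.+1), (fun k => extremal R m n k).
    split=> // j; split; first by rewrite subr_ge0 xdec.
    exact: kron_semigroup_extremal.
  rewrite functional_comb big1 // => k _.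
  have [_ [_ ->]] := gen _ (kron_semigroup_extremal (ltn_ord k)); first by rewrite mulr0.
  apply/tau_embed => //; [exact: is_partition_ones|exact: tail0_ones|exact: star_table_sums].
(* All terms are nonnegative, so each one vanishes: every generator with nonzero coefficient lies in
   [tau]. *)
rewrite functional_comb => /eqP; rewrite psumr_eq0 => [/allP h|j _]; last first.
  by have [cj /gen[gj _]] := cg j; apply: mulr_ge0.
apply: tau_comb => // j; first by case: (cg j).
have := h j (mem_index_enum j); rewrite /= mulf_eq0 => /orP[/eqP|/eqP e]; first by left.
by right; have [_ /gen[_ <-]] := cg j.
Qed.

Lemma tau_weakly_stable (x : pt) : tau x -> in_W x -> in_SKron x.
Proof.
move=> tx [[z xz] _]; have [_ [x0 xdec] [y0 ydec] [v0 vdec]] := tx.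
(* The coordinates of a point of [tau] are nonnegative, so taking absolute values of its integer
   coordinates loses nothing. *)
pose la := ordseq (fun i => `|z (inl (inl i))|%N).
pose mu := ordseq (fun i => `|z (inl (inr i))|%N).
pose nu := ordseq (fun i => `|z (inr i)|%N).
have absE t : 0 <= x t -> (`|z t|%N)%:R = x t.
  by rewrite xz ffunE ler0z => zt; rewrite -[in RHS](gez0_abs zt) pmulrn.
have decE t t' : 0 <= x t -> 0 <= x t' -> x t <= x t' -> (`|z t| <= `|z t'|)%N.
  by move=> xt xt' le; rewrite -(ler_nat R) !absE.
have laP : is_partition la by apply: is_partition_ordseq => i j ij; apply: decE => //; exact: xdec.
have muP : is_partition mu by apply: is_partition_ordseq => i j ij; apply: decE => //; exact: ydec.
have nuP : is_partition nu by apply: is_partition_ordseq => i j ij; apply: decE => //; exact: vdec.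
have la0 : tail0 (m * n) la by exact: tail0_ordseq.
have xE : x = embed R (m * n) m n la mu nu.
  by apply/ffunP=> -[[i|u]|v]; rewrite [RHS]ffunE nth_ordseq absE.
exists la, mu, nu; split=> //; try exact: ell_ordseq.
apply: (@star_weakly_stable m n) => //; try exact: tail0_ordseq.
by apply/(tau_embed R m0 n0 mu nu laP la0); rewrite -xE.
Qed.

End StableFace.

Theorem mainTheorem5 (R : realType) (m n : nat) :
  (0 < m)%N -> (0 < n)%N ->
  (forall la mu nu : seq nat,
     is_partition la -> is_partition mu -> is_partition nu ->
     (ell la <= m * n)%N -> (ell mu <= m)%N -> (ell nu <= n)%N ->
     star_eqs m n (fun i => nth 0%N la i.-1) (fun u => nth 0%N mu u.-1)
                  (fun v => nth 0%N nu v.-1) ->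
     stable_triple la mu nu)
  /\ stable_face (@tau R m n).
Proof.
move=> m0 n0; split=> [la mu nu laP muP nuP ella ellmu ellnu /star_eqsP-/(_ n0) st|].
  by apply: (star_stable m0 n0) st => //; exact: partition_tail0.
by split; [exact: tau_face|exact: tau_weakly_stable].
Qed.
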